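(* Let $\Gamma=(\gamma_{ij})$ be a skew-symmetric $n\times n$ matrix over $\mathbf{k}$ and let $P=(p_1,\dots,p_n),Q=(q_1,\dots,q_n)\in\mathbf{k}^n$ with $p_i\ne q_i$ for all $i$. The Poisson algebra $A_n=A_{n,\Gamma}^{P,Q}$ satisfies the Poisson Dixmier-Moeglin equivalence: for prime Poisson ideals of $A_n$ the properties of being symplectic, rational, and locally closed are equivalent. More precisely, $$\begin{aligned}\operatorname{symp}A_n&=\{\text{locally closed prime Poisson ideals of }A_n\}\\&=\{\text{rational prime Poisson ideals of }A_n\}\\&=\bigcup_T\{\text{maximal elements of }\operatorname{pspec}_TA_n\},\end{aligned}$$ where $T$ runs over all admissible sets of $A_n$ and $\operatorname{pspec}_TA_n$ is ordered by inclusion.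
   Context: $\mathbf{k}$ is an algebraically closed field of characteristic zero. A Poisson algebra is a commutative $\mathbf{k}$-algebra with a $\mathbf{k}$-bilinear Lie bracket $\{\cdot,\cdot\}$ satisfying $\{ab,c\}=a\{b,c\}+b\{a,c\}$; a Poisson ideal is an ideal $I$ with $\{I,A\}\subseteq I$; a prime Poisson ideal is a prime ideal that is also a Poisson ideal. $A_n=A_{n,\Gamma}^{P,Q}$ is the polynomial ring $\mathbf{k}[y_1,x_1,\dots,y_n,x_n]$ with the Poisson bracket determined by $\{y_i,y_j\}=\gamma_{ij}y_iy_j$ (all $i,j$); $\{x_i,y_j\}=(p_j-\gamma_{ij})y_jx_i$ ($i<j$); $\{y_i,x_j\}=-(q_i+\gamma_{ij})y_ix_j$ ($i<j$); $\{x_i,x_j\}=(q_i-p_j+\gamma_{ij})x_ix_j$ ($i<j$); $\{x_i,y_i\}=q_iy_ix_i+\sum_{k=1}^{i-1}(q_k-p_k)y_kx_k$ (all $i$). Put $\Omega_i=\sum_{k=1}^i(q_k-p_k)y_kx_k$ for $i=1,\dots,n$ and $\mathcal P_n=\{\Omega_1,y_1,x_1,\dots,\Omega_n,y_n,x_n\}$. A subset $T\subseteq\mathcal P_n$ is admissible if (a) for $2\le i\le n$: ($y_i\in T$ or $x_i\in T$) $\Leftrightarrow$ ($\Omega_i\in T$ and $\Omega_{i-1}\in T$); (b) ($y_1\in T$ or $x_1\in T$) $\Leftrightarrow$ $\Omega_1\in T$. For admissible $T$, $\operatorname{pspec}_TA_n$ is the set of prime Poisson ideals $P'$ of $A_n$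 with $P'\cap\mathcal P_n=T$. A Poisson ideal $N$ of a Poisson algebra $A$ is symplectic if there is a maximal ideal $M$ of $A$ such that $N$ is the largest Poisson ideal contained in $M$; $\operatorname{symp}A$ is the set of symplectic ideals. A prime Poisson ideal $P'$ is rational if the Poisson center $\{a: \{a,b\}=0\ \forall b\}$ of the quotient field of $A/P'$ (with the induced Poisson bracket) is algebraic over $\mathbf{k}$. It is locally closed if the intersection of all prime Poisson ideals properly containing $P'$ is strictly larger than $P'$ (the empty intersection being $A$). *)

(* Defs.v *)
From HB Require Import structures.
From mathcomp Require Import all_boot all_order all_algebra.
From mathcomp Require Import generic_quotient ring_quotient fraction.
From mathcomp Require Import boolp classical_sets.
From mathcomp Require Import mpoly.
From mathcomp Require Import ring.

Set Implicit Arguments.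
Unset Strict Implicit.
Unset Printing Implicit Defensive.
Import GRing.Theory.
Local Open Scope ring_scope.
Local Open Scope classical_set_scope.
Local Open Scope quotient_scope.

Section PoissonBrackets.
Variables (k : fieldType) (A : comAlgType k).

Record poisson_bracket (br : A -> A -> A) : Prop := PoissonBracket {
  pb_linl : forall c : A, linear (br^~ c);
  pb_linr : forall a : A, linear (br a);
  pb_alt : forall a, br a a = 0;
  pb_jacobi : forall a b c, br a (br b c) + br b (br c a) + br c (br a b) = 0;
  pb_leibniz : forall a b c, br (a * b) c = a * br b c + b * br a c }.

End PoissonBrackets.

Section Ideals.
Variable A : comNzRingType.
Implicit Types (I J M : set A) (br : A -> A -> A).

(* The library's [idealr] is proper and boolean; here the unit ideal counts as
   an ideal, and properness is part of primality and maximality. *)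
Definition ideal I : Prop :=
  [/\ I 0, forall a b, I a -> I b -> I (a + b) & forall a b, I b -> I (a * b)].

Definition prime_ideal I : Prop :=
  [/\ ideal I, ~ I 1 & forall a b, I (a * b) -> I a \/ I b].

Definition maximal_ideal M : Prop :=
  [/\ ideal M, M <> setT &
      forall J, ideal J -> M `<=` J -> J = M \/ J = setT].

Definition poisson_ideal br I : Prop :=
  ideal I /\ forall a b, I a -> I (br a b).

Definition prime_poisson_ideal br I : Prop :=
  prime_ideal I /\ poisson_ideal br I.

Definition symp br : set (set A) :=
  [set N | exists M, [/\ maximal_ideal M, poisson_ideal br N, N `<=` M &
                         forall J, poisson_ideal br J -> J `<=` M -> J `<=` N]].

Definition locally_closed br : set (set A) :=
  [set I | prime_poisson_ideal br I /\
           I `<` \bigcap_(J in [set J | prime_poisson_ideal br J /\ I `<` J]) J].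

End Ideals.

Section PrimeQuotient.
Variables (A : comNzRingType) (I : set A) (primeI : prime_ideal I).

Definition ideal_pred (_ : prime_ideal I) : pred A := fun a => `[< I a >].
Local Notation Ip := (ideal_pred primeI).

Fact ideal_pred_idealr : idealr_closed Ip.
Proof.
have [[I0 ID IM] I1 _] := primeI; split.
- exact/asboolP.
- exact/asboolP.
- move=> a u v /asboolP uI /asboolP vI; apply/asboolP.
  by apply: ID => //; apply: IM.
Qed.

Fact ideal_pred_prime : prime_idealr_closed Ip.
Proof.
have [_ _ IP] := primeI; move=> u v /asboolP /IP [] uvI; apply/orP.
- by left; apply/asboolP.
- by right; apply/asboolP.
Qed.

HB.instance Definition _ := isIdealr.Build A Ip ideal_pred_idealr.
HB.instance Definition _ := isPrimeIdealrClosed.Build A Ip ideal_pred_prime.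

(* The library makes [{ideal_quot _}] a commutative ring only; [{fraction _}]
   also needs a (here classical) choice of inverses. *)
Definition prime_quot := {ideal_quot (PrimeIdealr.clone A Ip _)}.
HB.instance Definition _ := GRing.ComNzRing.on prime_quot.
HB.instance Definition _ := EqQuotient.on prime_quot.

Definition prime_quot_unit : pred prime_quot :=
  fun x => `[< exists y, y * x = 1 >].
Definition prime_quot_inv (x : prime_quot) : prime_quot :=
  xget x [set y | y * x = 1].

Fact prime_quot_mulVx : {in prime_quot_unit, left_inverse 1 prime_quot_inv *%R}.
Proof. by move=> x /asboolP ex; rewrite /prime_quot_inv; apply: (xgetPex x ex). Qed.

Fact prime_quot_unitPl (x y : prime_quot) : y * x = 1 -> prime_quot_unit x.
Proof. by move=> yx1; apply/asboolP; exists y. Qed.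

Fact prime_quot_inv_out : {in [predC prime_quot_unit], prime_quot_inv =1 id}.
Proof.
move=> x /asboolPn nx; rewrite /prime_quot_inv.
by case: xgetP => // y _ yx1; case: nx; exists y.
Qed.

HB.instance Definition _ := GRing.ComNzRing_hasMulInverse.Build prime_quot
  prime_quot_mulVx prime_quot_unitPl prime_quot_inv_out.
HB.instance Definition _ := GRing.ComUnitRing_isIntegral.Build prime_quot
  (@Quotient.rquot_IdomainAxiom A Ip).

Variable br : A -> A -> A.

(* Computed on representatives; well defined when [I] is a Poisson ideal. *)
Definition quot_bracket (u v : prime_quot) : prime_quot :=
  \pi_prime_quot (br (repr u) (repr v)).

Lemma quot_bracket_pi a b : poisson_ideal br I ->
  (forall c, additive (br^~ c)) -> (forall a b, br b a = - br a b) ->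
  quot_bracket (\pi_prime_quot a) (\pi_prime_quot b) = \pi_prime_quot (br a b).
Proof.
move=> [[_ ID _] brI] brl bra.
have brB c a' b' : br (a' - b') c = br a' c - br b' c by apply: (brl c).
have IE (a' b' : A) : I (a' - b') <-> \pi_prime_quot a' = \pi_prime_quot b'.
  split=> [Iab|/eqmodP /asboolP //].
  by apply/eqmodP; apply/asboolP.
have key (a' b' c : A) : \pi_prime_quot a' = \pi_prime_quot b' ->
    \pi_prime_quot (br a' c) = \pi_prime_quot (br b' c).
  by move=> /IE Iab; apply/IE; rewrite -brB; apply: brI.
rewrite /quot_bracket.
rewrite (key _ a); last by rewrite reprK.
rewrite bra [in RHS]bra !rmorphN; congr (- _).
by apply: key; rewrite reprK.
Qed.

End PrimeQuotient.

Section FractionBracket.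
Variables (D : idomainType) (br : D -> D -> D).

(* The quotient rule in both arguments:
   {a/b, c/d} = ({a,c} b d - {a,d} b c - {b,c} a d + {b,d} a c) / (b d)^2. *)
Definition frac_bracket (u v : {fraction D}) : {fraction D} :=
  let: (a, b) := frac (repr u) in
  let: (c, d) := frac (repr v) in
  FracField.tofrac (br a c * (b * d) - br a d * (b * c)
                    - br b c * (a * d) + br b d * (a * c))
  / FracField.tofrac ((b * d) ^+ 2).

Lemma frac_bracket_div a b c d :
  (forall a b, br b a = - br a b) ->
  (forall a b c, br (a * b) c = a * br b c + b * br a c) ->
  b != 0 -> d != 0 ->
  frac_bracket (FracField.tofrac a / FracField.tofrac b)
               (FracField.tofrac c / FracField.tofrac d)
  = FracField.tofrac (br a c * (b * d) - br a d * (b * c)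
                      - br b c * (a * d) + br b d * (a * c))
    / FracField.tofrac ((b * d) ^+ 2).
Proof.
move=> bra brm b0 d0; rewrite /frac_bracket.
have reprE (u : {fraction D}) a' b' : b' != 0 ->
    u = FracField.tofrac a' / FracField.tofrac b' ->
    (frac (repr u)).1 * b' = a' * (frac (repr u)).2.
  move=> nb' uE.
  have rE : u = FracField.tofrac (frac (repr u)).1 / FracField.tofrac (frac (repr u)).2.
    rewrite -{1}[u]reprK; move: (repr u) => r; rewrite -{1}[r]Ratio_numden.
    unlock FracField.tofrac.
    rewrite -[_^-1]FracField.pi_inv -[RHS]FracField.pi_mul.
    rewrite /FracField.invf /FracField.mulf !numden_Ratio ?oner_neq0 ?denom_ratioP //.
    by rewrite mulr1 mul1r.
  have /eqP := etrans (esym uE) rE; rewrite eqr_div ?tofrac_eq0 ?denom_ratioP //.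
  by rewrite -!rmorphM tofrac_eq => /eqP <-.
set u := (FracField.tofrac a / FracField.tofrac b).
set v := (FracField.tofrac c / FracField.tofrac d).
have := reprE u a b b0 erefl; have := reprE v c d d0 erefl.
move: (denom_ratioP (repr u)) (denom_ratioP (repr v)).
case: (frac (repr u)) => a' b'; case: (frac (repr v)) => c' d' /=.
move=> b'0 d'0 Ec Ea.
apply/eqP; rewrite eqr_div ?tofrac_eq0 ?expf_neq0 ?mulf_neq0 //.
rewrite -!rmorphM tofrac_eq; apply/eqP => {u v}.
have dl e u v u' v' : u' * v = u * v' ->
    (v' * br u' e - u' * br v' e) * v ^+ 2 = (v * br u e - u * br v e) * v' ^+ 2.
  move=> E; have := congr1 (br^~ e) E; rewrite !brm.
  move: (br u e) (br v e) (br u' e) (br v' e) => U V U' V' F.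
  apply/eqP; rewrite -subr_eq0.
  have -> : (v' * U' - u' * V') * v ^+ 2 - (v * U - u * V) * v' ^+ 2
    = v * v' * ((u' * V + v * U') - (u * V' + v' * U))
      + (v * V' + v' * V) * (u * v' - u' * v) by ring.
  by rewrite F E !subrr !mulr0 addr0.
pose N p q r s := br p r * (q * s) - br p s * (q * r) - br q r * (p * s)
                  + br q s * (p * r).
have NC p q r s : N r s p q = - N p q r s.
  by rewrite /N (bra p r) (bra p s) (bra q r) (bra q s); ring.
have step u v u' v' r s : u' * v = u * v' ->
    N u' v' r s * v ^+ 2 = N u v r s * v' ^+ 2.
  move=> E; have Er := dl r _ _ _ _ E; have Es := dl s _ _ _ _ E.
  have NE p q : N p q r s = s * (q * br p r - p * br q r)
                            - r * (q * br p s - p * br q s) by rewrite /N; ring.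
  by rewrite !NE !mulrBl -!mulrA Er Es.
rewrite -/(N a' b' c' d') -/(N a b c d).
have S1 := step a b a' b' c' d' Ea; have S2 := step c d c' d' a b Ec.
rewrite !exprMn mulrA S1 mulrAC -[N a b c' d']opprK -NC mulNr S2.
by rewrite NC; ring.
Qed.

Definition poisson_center_frac : set {fraction D} :=
  [set u | forall v, frac_bracket u v = 0].

End FractionBracket.

Section Rational.
Variables (k : fieldType) (A : comAlgType k) (br : A -> A -> A).

Definition scalar_frac (I : set A) (primeI : prime_ideal I) (c : k) :
    {fraction (prime_quot primeI)} :=
  FracField.tofrac (\pi_(prime_quot primeI) c%:A).

Definition rational : set (set A) :=
  [set I | prime_poisson_ideal br I /\
     exists primeI : prime_ideal I,
       forall u, poisson_center_frac (@quot_bracket A I primeI br) u ->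
         algebraicOver (scalar_frac primeI) u].

Definition poisson_dixmier_moeglin : Prop :=
  forall I, prime_poisson_ideal br I ->
    (symp br I <-> rational I) /\ (rational I <-> locally_closed br I).

End Rational.

Section Jacobiator.
Variables (k : fieldType) (A : comAlgType k) (br : A -> A -> A).
Local Notation "{[ f , g ]}" := (br f g).

Definition jacobiator a b c :=
  {[ a, {[ b, c ]} ]} + {[ b, {[ c, a ]} ]} + {[ c, {[ a, b ]} ]}.

Hypothesis br_linl : forall c, linear (br^~ c).
Hypothesis br_anti : forall a b, {[ b, a ]} = - {[ a, b ]}.
Hypothesis br_leib : forall a b c, {[ a * b, c ]} = a * {[ b, c ]} + b * {[ a, c ]}.

Let br0l f : {[ 0, f ]} = 0.
Proof. by have := br_linl f (-1) 0 0; rewrite !scaleN1r !addNr. Qed.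
Let brDl f g h : {[ f + g, h ]} = {[ f, h ]} + {[ g, h ]}.
Proof. by have := br_linl h 1 f g; rewrite !scale1r. Qed.
Let brZl c f h : {[ c *: f, h ]} = c *: {[ f, h ]}.
Proof. by have := br_linl h c f 0; rewrite br0l !addr0. Qed.
Let brDr f g h : {[ h, f + g ]} = {[ h, f ]} + {[ h, g ]}.
Proof. by rewrite br_anti brDl opprD -!br_anti. Qed.
Let brZr c f h : {[ h, c *: f ]} = c *: {[ h, f ]}.
Proof. by rewrite br_anti brZl -scalerN -br_anti. Qed.
Let br0r f : {[ f, 0 ]} = 0.
Proof. by rewrite br_anti br0l oppr0. Qed.
Let brNr f h : {[ h, - f ]} = - {[ h, f ]}.
Proof. by rewrite -scaleN1r brZr scaleN1r. Qed.
Let brMr f g h : {[ h, f * g ]} = f * {[ h, g ]} + g * {[ h, f ]}.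
Proof. by rewrite br_anti br_leib ![{[ _, h ]}]br_anti; ring. Qed.

Let scaleE c (f : A) : c *: f = in_alg A c * f.
Proof. by rewrite /= mulr_algl. Qed.

Lemma jacobiatorC a b c : jacobiator a b c = jacobiator b c a.
Proof. by rewrite /jacobiator -addrA addrC. Qed.

Lemma jacobiatorN a b c : jacobiator b a c = - jacobiator a b c.
Proof.
rewrite /jacobiator (br_anti a b) (br_anti b c) (br_anti c a) !brNr; ring.
Qed.

Lemma jacobiator_rep u v : {[ u, u ]} = 0 -> jacobiator u u v = 0.
Proof.
by move=> uu; rewrite /jacobiator uu br0r (br_anti u v) brNr subrr addr0.
Qed.

Lemma jacobiator_linear b c : linear (fun a => jacobiator a b c).
Proof.
move=> s f g; rewrite /jacobiator !(brDl, brZl, brDr, brZr) !scalerDr.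
by rewrite (AC (2*2*2) (1*3*5*(2*4*6))).
Qed.

Lemma jacobiator_leibniz b c f g :
  jacobiator (f * g) b c = f * jacobiator g b c + g * jacobiator f b c.
Proof.
rewrite /jacobiator !(br_leib, brMr, brDr).
rewrite ?(br_anti f c) ?(br_anti g c) ?(br_anti f b) ?(br_anti g b) !(brDr, brNr, brMr) ?(br_anti f c) ?(br_anti g c) ?(br_anti f b) ?(br_anti g b).
ring.
Qed.

(* Three elements with pairwise brackets scalar multiples of the products. *)
Lemma jacobiator_log (l m n : k) a b c :
  {[ a, b ]} = l *: (a * b) -> {[ b, c ]} = m *: (b * c) ->
  {[ c, a ]} = n *: (c * a) -> jacobiator a b c = 0.
Proof.
move=> ab bc ca; rewrite /jacobiator ab bc ca !(brZr, brMr) ab bc ca.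
rewrite (br_anti c a) (br_anti a b) (br_anti b c) ab bc ca !scaleE.
ring.
Qed.

Lemma jacobiator_pair (q l m : k) u v w z :
  {[ u, v ]} = q *: (v * u) + w -> {[ v, z ]} = l *: (v * z) ->
  {[ u, z ]} = m *: (u * z) -> {[ w, z ]} = (l + m) *: (w * z) ->
  jacobiator u v z = 0.
Proof.
move=> uv vz uz wz; rewrite /jacobiator (br_anti u z) uv vz uz.
rewrite !(brNr, brDr, brZr, brMr) (br_anti u z) (br_anti v z) (br_anti w z).
rewrite (br_anti u v) uv vz uz wz !scaleE.
ring.
Qed.

Lemma br_algebra c (l m : k) u v :
  {[ u, c ]} = l *: (u * c) -> {[ v, c ]} = m *: (v * c) ->
  {[ u * v, c ]} = (l + m) *: (u * v * c).
Proof.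
by move=> uc vc; rewrite br_leib uc vc !scaleE; ring.
Qed.

Lemma jacobiator_Omega (e p q : k) (u w z : A) :
  (e * p) *: (w * z) + (q - p) *: (z * (e *: (q *: u + w)))
    = (e * q) *: ((w + (q - p) *: u) * z).
Proof. by rewrite !scaleE; ring. Qed.

End Jacobiator.

Section PoissonAn.
Variables (k : fieldType) (n : nat) (Gamma : 'M[k]_n) (P Q : 'rV[k]_n).

Local Notation An := {mpoly k[n + n]}.

Definition gen_y (i : 'I_n) : An := 'X_(lshift n i).
Definition gen_x (i : 'I_n) : An := 'X_(rshift n i).

Definition Omega (i : 'I_n) : An :=
  \sum_(l < n | (l <= i)%N) (Q 0 l - P 0 l) *: (gen_y l * gen_x l).

(* {x_i, y_j}; for j < i it is minus the prescribed value of {y_j, x_i} *)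
Definition xy_bracket (i j : 'I_n) : An :=
  if (i < j)%N then (P 0 j - Gamma i j) *: (gen_y j * gen_x i)
  else if (j < i)%N then (Q 0 j + Gamma j i) *: (gen_y j * gen_x i)
  else Q 0 i *: (gen_y i * gen_x i)
       + \sum_(l < n | (l < i)%N) (Q 0 l - P 0 l) *: (gen_y l * gen_x l).

Definition xx_bracket (i j : 'I_n) : An :=
  if (i < j)%N then (Q 0 i - P 0 j + Gamma i j) *: (gen_x i * gen_x j)
  else if (j < i)%N then - ((Q 0 j - P 0 i + Gamma j i) *: (gen_x j * gen_x i))
  else 0.

Definition gen_bracket (a b : 'I_(n + n)) : An :=
  match split a, split b with
  | inl i, inl j => Gamma i j *: (gen_y i * gen_y j)
  | inr i, inl j => xy_bracket i j
  | inl i, inr j => - xy_bracket j i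
  | inr i, inr j => xx_bracket i j
  end.

(* The biderivation with the prescribed values on the variables. *)
Definition An_bracket (f g : An) : An :=
  \sum_(a < n + n) \sum_(b < n + n)
     mderiv a f * mderiv b g * gen_bracket a b.

Definition calP : set An := range Omega `|` range gen_y `|` range gen_x.

(* Indices start at 0, so clause (a) is about pairs i = j + 1. *)
Definition admissible : set (set An) :=
  [set T | [/\ T `<=` calP,
    forall i j : 'I_n, i = j.+1 :> nat ->
      (T (gen_y i) \/ T (gen_x i) <-> T (Omega i) /\ T (Omega j)) &
    forall i : 'I_n, i = 0 :> nat ->
      (T (gen_y i) \/ T (gen_x i) <-> T (Omega i))]].

Definition pspec (T : set An) : set (set An) :=
  [set I | prime_poisson_ideal An_bracket I /\ I `&` calP = T].

Section BracketProperties.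
Hypothesis Gamma_skew : Gamma^T = - Gamma.
Hypothesis char0 : [pchar k] =i pred0.

Lemma Gamma_opp i j : Gamma j i = - Gamma i j.
Proof. by have /matrixP/(_ i j) := Gamma_skew; rewrite !mxE. Qed.

Lemma nz2 : 2%:R != 0 :> k.
Proof. by apply: contraFN (char0 2) => h2; rewrite inE /= h2. Qed.

Lemma Gamma_diag i : Gamma i i = 0.
Proof.
have h : Gamma i i *+ 2 = 0 by rewrite mulr2n {1}Gamma_opp addNr.
move/eqP: h; rewrite -mulr_natl mulf_eq0 (negbTE nz2) /= => /eqP //.
Qed.

Lemma gen_bracket_opp a b : gen_bracket b a = - gen_bracket a b.
Proof.
rewrite /gen_bracket; case: (split a) => i; case: (split b) => j; rewrite ?opprK //.
  by rewrite Gamma_opp [gen_y j * _]mulrC scaleNr.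
rewrite /xx_bracket; case: ltngtP; rewrite ?opprK ?oppr0 //.
Qed.

Lemma gen_bracketaa a : gen_bracket a a = 0.
Proof.
rewrite /gen_bracket; case: (split a) => i; first by rewrite Gamma_diag scale0r.
by rewrite /xx_bracket ltnn.
Qed.

Local Notation "{[ f , g ]}" := (An_bracket f g).

Lemma An_bracketC f g : {[ g, f ]} = - {[ f, g ]}.
Proof.
rewrite /An_bracket exchange_big -sumrN; apply: eq_bigr => a _.
rewrite -sumrN; apply: eq_bigr => b _.
by rewrite gen_bracket_opp mulrN [mderiv b g * _]mulrC.
Qed.

Lemma An_bracket_linl h : linear (An_bracket^~ h).
Proof.
move=> c f g; rewrite /An_bracket scaler_sumr -big_split; apply: eq_bigr => a _ /=.
rewrite scaler_sumr -big_split; apply: eq_bigr => b _ /=.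
by rewrite linearP /= !mulrDl -!scalerAl.
Qed.

Lemma An_bracket_linr h : linear (An_bracket h).
Proof.
by move=> c f g; rewrite An_bracketC An_bracket_linl opprD -scalerN -!An_bracketC.
Qed.

Lemma An_bracket_leibniz f g h : {[ f * g, h ]} = f * {[ g, h ]} + g * {[ f, h ]}.
Proof.
rewrite /An_bracket !mulr_sumr -big_split; apply: eq_bigr => a _ /=.
rewrite !mulr_sumr -big_split; apply: eq_bigr => b _ /=.
by rewrite mderivM; ring.
Qed.

Lemma An_bracket_leibnizr f g h : {[ h, f * g ]} = f * {[ h, g ]} + g * {[ h, f ]}.
Proof. by rewrite An_bracketC An_bracket_leibniz ![{[ _, h ]}]An_bracketC; ring. Qed.

Lemma mderivXU (a b : 'I_(n + n)) : mderiv a ('X_b : An) = (a == b)%:R.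
Proof.
rewrite mderivX mnm1E eq_sym; case: eqVneq => [->|_]; last by rewrite scale0r.
by rewrite scale1r -mpolyX0; congr mpolyX; apply/mnmP => c; rewrite mnmBE subnn mnm0E.
Qed.

Lemma An_bracketXX (a b : 'I_(n + n)) : {[ 'X_a, 'X_b ]} = gen_bracket a b.
Proof.
rewrite /An_bracket (bigD1 a) //= (bigD1 b) //= !mderivXU !eqxx !mul1r.
rewrite big1 ?addr0 => [|c /negbTE cb]; last by rewrite !mderivXU cb mulr0 mul0r.
rewrite big1 ?addr0 // => c /negbTE ca; rewrite big1 // => d _.
by rewrite !mderivXU ca !mul0r.
Qed.

Lemma An_bracket_rel :
  [/\ forall i j, {[ gen_y i, gen_y j ]} = Gamma i j *: (gen_y i * gen_y j),
      forall i j : 'I_n, (i < j)%N ->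
        {[ gen_x i, gen_y j ]} = (P 0 j - Gamma i j) *: (gen_y j * gen_x i),
      forall i j : 'I_n, (i < j)%N ->
        {[ gen_y i, gen_x j ]} = - (Q 0 i + Gamma i j) *: (gen_y i * gen_x j),
      forall i j : 'I_n, (i < j)%N ->
        {[ gen_x i, gen_x j ]}
          = (Q 0 i - P 0 j + Gamma i j) *: (gen_x i * gen_x j) &
      forall i : 'I_n,
        {[ gen_x i, gen_y i ]} = Q 0 i *: (gen_y i * gen_x i)
          + \sum_(l < n | (l < i)%N) (Q 0 l - P 0 l) *: (gen_y l * gen_x l)].
Proof.
have sl (i : 'I_n) : split (lshift n i) = inl i by apply: (unsplitK (inl i)).
have sr (i : 'I_n) : split (rshift n i) = inr i by apply: (unsplitK (inr i)).
split=> i; rewrite /gen_x /gen_y; last first.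
  by rewrite An_bracketXX /gen_bracket sl sr /xy_bracket ltnn.
all: move=> j; rewrite An_bracketXX /gen_bracket !(sl, sr) //.
all: rewrite /xy_bracket /xx_bracket; case: ltngtP => // _ _.
by rewrite scaleNr.
Qed.

Lemma derivation_eq0 (D : An -> An) : linear D ->
  (forall f g, D (f * g) = f * D g + g * D f) ->
  (forall a : 'I_(n + n), D 'X_a = 0) -> forall f, D f = 0.
Proof.
move=> Dlin DM DX.
have D0 : D 0 = 0 by have := Dlin (-1) 0 0; rewrite !scaleN1r !addNr.
have D1 : D 1 = 0.
  by apply: (@addrI _ (D 1)); rewrite addr0; have := DM 1 1; rewrite !mul1r.
have DXn (a : 'I_(n + n)) m : D ('X_a ^+ m) = 0.
  by elim: m => [|m IH]; rewrite ?expr0 // exprS DM IH DX !mulr0 addr0.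
have DXm (m : 'X_{1..n + n}) : D 'X_[m] = 0.
  rewrite mpolyXE_id; elim/big_rec: _ => // a f _ Df.
  by rewrite DM Df DXn !mulr0 addr0.
by elim/mpolyind => // c m f _ _ Df; rewrite Dlin DXm Df scaler0 addr0.
Qed.

Lemma An_bracket_alt f : {[ f, f ]} = 0.
Proof.
apply: (scalerI nz2); rewrite scaler0 scaler_nat mulr2n {1}An_bracketC.
exact: addNr.
Qed.

Let brl := An_bracket_linl.
Let bra := fun f g => An_bracketC f g.
Let brm := An_bracket_leibniz.

Let gv (t : bool) (i : 'I_n) := if t then gen_x i else gen_y i.

Let gvP (a : 'I_(n + n)) : exists t i, 'X_a = gv t i.
Proof.
rewrite -(splitK a); case: (split a) => i; first by exists false, i.
by exists true, i.
Qed.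

Let lam (t : bool) (i : 'I_n) (s : bool) (j : 'I_n) : k :=
  match t, s with
  | false, false => Gamma i j
  | true, false => if (i < j)%N then P 0 j - Gamma i j else Q 0 j + Gamma j i
  | false, true => if (j < i)%N then - (P 0 i - Gamma j i) else - (Q 0 i + Gamma i j)
  | true, true => if (i < j)%N then Q 0 i - P 0 j + Gamma i j
                  else - (Q 0 j - P 0 i + Gamma j i)
  end.

Let gv_log t (i : 'I_n) s (j : 'I_n) : i != j ->
  {[ gv t i, gv s j ]} = lam t i s j *: (gv t i * gv s j).
Proof.
have [yy xy yx xx _] := An_bracket_rel => ij.
case: t s => [] [] /=.
- case: ltngtP => [ltij|ltji|/val_inj eij]; last by rewrite eij eqxx in ij.
    by rewrite xx.
  by rewrite bra xx // scaleNr mulrC.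
- case: ltngtP => [ltij|ltji|/val_inj eij]; last by rewrite eij eqxx in ij.
    by rewrite xy // mulrC.
  by rewrite bra yx // scaleNr opprK mulrC.
- case: ltngtP => [ltji|ltij|/val_inj eij]; last by rewrite eij eqxx in ij.
    by rewrite bra xy // scaleNr.
  by rewrite yx // scaleNr.
- by rewrite yy.
Qed.

Let lamD (i : 'I_n) s (j : 'I_n) : i != j -> lam false i s j + lam true i s j =
  (-1) ^+ s * (if (i < j)%N then P 0 j else Q 0 j).
Proof.
move=> ij; rewrite /lam; case: s; case: ltngtP => [ltij|ltji|/val_inj eij];
  rewrite ?expr1 ?expr0; try (by rewrite eij eqxx in ij);
  rewrite ?(Gamma_opp i j); ring.
Qed.

Let Om (m : nat) : An :=
  \sum_(l < n | (l < m)%N) (Q 0 l - P 0 l) *: (gen_y l * gen_x l).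

Let Om0 : Om 0 = 0. Proof. by apply: big1. Qed.

Let OmS (i : 'I_n) :
  Om i.+1 = Om i + (Q 0 i - P 0 i) *: (gen_y i * gen_x i).
Proof.
rewrite /Om (bigD1 i) //= addrC; congr (_ + _); apply: eq_bigl => l.
by rewrite ltnS ltn_neqAle andbC.
Qed.

Let br_pair (i : 'I_n) :
  {[ gen_x i, gen_y i ]} = Q 0 i *: (gen_y i * gen_x i) + Om i.
Proof. by have [_ _ _ _ ->] := An_bracket_rel. Qed.

Let brD f g h : {[ f + g, h ]} = {[ f, h ]} + {[ g, h ]}.
Proof. by have := brl h 1 f g; rewrite !scale1r. Qed.
Let br0 f : {[ 0, f ]} = 0.
Proof. by have := brl f (-1) 0 0; rewrite !scaleN1r !addNr. Qed.
Let brZ c f h : {[ c *: f, h ]} = c *: {[ f, h ]}.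
Proof. by have := brl h c f 0; rewrite br0 !addr0. Qed.

Let br_Om s (j : 'I_n) m : (m <= n)%N -> {[ Om m, gv s j ]} =
  ((-1) ^+ s * (if (m <= j)%N then P 0 j else Q 0 j)) *: (Om m * gv s j).
Proof.
elim: m => [|m IH] ltmn; first by rewrite Om0 br0 mul0r scaler0.
have {IH} := IH (ltnW ltmn); rewrite -[m]/(val (Ordinal ltmn)).
move: (Ordinal ltmn) => i {m ltmn} /= IH.
rewrite OmS brD brZ IH {IH}.
have [->|ij] := eqVneq i j; last first.
  rewrite (br_algebra brm (gv_log false s ij) (gv_log true s ij)) lamD //.
  have -> : (i <= j)%N = (i < j)%N.
    by rewrite leq_eqVlt; case: eqP => // /val_inj eij; rewrite eij eqxx in ij.
  by rewrite mulrDl scalerDr -!scalerAl !scalerA [_ * (_ * _)]mulrC.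
rewrite leqnn ltnn brm.
rewrite -jacobiator_Omega; congr (_ + _ *: _).
have := br_pair j; move: (Om j) => w; case: s => /= xy.
  by rewrite An_bracket_alt mulr0 add0r bra xy expr1 scaleN1r.
by rewrite An_bracket_alt mulr0 addr0 xy expr0 scale1r.
Qed.

Lemma An_bracket_jacobi f g h :
  {[ f, {[ g, h ]} ]} + {[ g, {[ h, f ]} ]} + {[ h, {[ f, g ]} ]} = 0.
Proof.
rewrite -/(jacobiator An_bracket f g h).
have jC := @jacobiatorC _ _ An_bracket.
have jL := jacobiator_linear brl bra.
have jM := jacobiator_leibniz brl bra brm.
move: f; apply: (derivation_eq0 (jL g h) (jM g h)) => a; rewrite jC.
move: g; apply: (derivation_eq0 (jL h 'X_a) (jM h 'X_a)) => b; rewrite jC.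
move: h; apply: (derivation_eq0 (jL 'X_a 'X_b) (jM 'X_a 'X_b)) => c.
have [t [i ->]] := gvP c; have [s [j ->]] := gvP a; have [r [l ->]] := gvP b.
move=> {a b c}.
have log t' i' s' j' : (i' != j') || (t' == s') ->
    exists e, {[ gv t' i', gv s' j' ]} = e *: (gv t' i' * gv s' j').
  have [<- /= /eqP <-|ij _] := eqVneq i' j'; last by eexists; apply: gv_log.
  by exists 0; rewrite An_bracket_alt scale0r.
have bad i' r' l' : jacobiator An_bracket (gv true i') (gv false i') (gv r' l') = 0.
  have [<-|il] := eqVneq i' l'.
    case: r' => /=; last by rewrite jC; apply: (jacobiator_rep brl bra) (An_bracket_alt _).
    by rewrite -jC; apply: (jacobiator_rep brl bra) (An_bracket_alt _).
  apply: (jacobiator_pair brl bra brm (br_pair i') (gv_log false r' il)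
      (gv_log true r' il)).
  rewrite lamD // br_Om; last exact: ltnW.
  have -> // : (i' <= l')%N = (i' < l')%N.
  by rewrite leq_eqVlt; case: eqP => // /val_inj eij; rewrite eij eqxx in il.
have bad2 i' t' s' r' l' : t' != s' ->
    jacobiator An_bracket (gv t' i') (gv s' i') (gv r' l') = 0.
  case: t' s' => [] [] // _.
  by rewrite (jacobiatorN brl bra) bad oppr0.
have [/log [e1 E1]|] := boolP ((i != j) || (t == s)); last first.
  by rewrite negb_or negbK => /andP[/eqP <- ts]; apply: bad2.
have [/log [e2 E2]|] := boolP ((j != l) || (s == r)); last first.
  by rewrite negb_or negbK => /andP[/eqP <- ts]; rewrite jC; apply: bad2.
have [/log [e3 E3]|] := boolP ((l != i) || (r == t)); last first.
  by rewrite negb_or negbK => /andP[/eqP <- ts]; rewrite -jC; apply: bad2.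
exact: (jacobiator_log brl bra brm E1 E2 E3).
Qed.

Lemma An_poisson_bracket : poisson_bracket An_bracket.
Proof.
split.
- exact: An_bracket_linl.
- exact: An_bracket_linr.
- exact: An_bracket_alt.
- exact: An_bracket_jacobi.
- exact: An_bracket_leibniz.
Qed.

End BracketProperties.

End PoissonAn.

Definition maximal_elements (T : Type) (X : set (set T)) : set (set T) :=
  [set I | X I /\ forall J, X J -> I `<=` J -> J = I].

(* Main.v *)
(* The chain is: maximal in its stratum pspec_T => locally closed => symplectic
   => rational => maximal in its stratum.
   - A prime strictly above a maximal element of pspec_T contains one of the
     elements of calP outside T, so all of them contain the product of those.
   - The largest Poisson ideal inside a prime is prime in characteristic 0; with
     the Jacobson property of polynomial rings this yields "symplectic".
   - If a / b is central modulo the core of a maximal ideal M, its denominators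
     form a Poisson ideal not inside M, so a / b has a value at M; subtracting
     this value leaves a central fraction vanishing at M, which must be 0 since
     otherwise its inverse, being central too, would have a value at M.
   - Modulo a Poisson prime I, and up to inverting some y_i, the algebra is
     spanned by monomials in elements with pairwise log-canonical brackets.  If J
     contains I and meets calP in the same set, a shortest sum of such monomials
     in J outside I, divided by one of its terms, is a central fraction that is
     not a scalar. *)

Require Import Defs.
From mathcomp Require Import all_boot all_order all_algebra.
From mathcomp Require Import generic_quotient ring_quotient fraction.
From mathcomp Require Import boolp classical_sets.
From mathcomp Require Import mpoly ring.

Set Implicit Arguments.
Unset Strict Implicit.
Unset Printing Implicit Defensive.
Import GRing.Theory.
Local Open Scope ring_scope.
Local Open Scope classical_set_scope.

(** * Ideals and the Nullstellensatz *)

Section Ideals.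
Variables (A : comNzRingType) (I : set A).

Section Ideal.
Hypothesis idI : ideal I.

Lemma ideal0 : I 0. Proof. by have [] := idI. Qed.
Lemma idealD a b : I a -> I b -> I (a + b). Proof. by have [_ h _] := idI; apply: h. Qed.
Lemma idealMl a b : I b -> I (a * b). Proof. by have [_ _ h] := idI; apply: h. Qed.
Lemma idealMr a b : I a -> I (a * b). Proof. by rewrite mulrC; apply: idealMl. Qed.
Lemma idealN a : I a -> I (- a). Proof. by rewrite -mulN1r; apply: idealMl. Qed.
Lemma idealB a b : I a -> I b -> I (a - b).
Proof. by move=> Ia Ib; apply: idealD => //; apply: idealN. Qed.
Lemma idealBr a b : I (a - b) -> I b -> I a.
Proof. by move=> Iab Ib; rewrite -(subrK b a); apply: idealD. Qed.
Lemma idealBl a b : I (a - b) -> I a -> I b.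
Proof. by move=> Iab Ia; rewrite -(subKr a b); apply: idealB. Qed.

Lemma ideal_sum (J : Type) (r : seq J) (p : pred J) (F : J -> A) :
  (forall j, p j -> I (F j)) -> I (\sum_(j <- r | p j) F j).
Proof. by move=> IF; apply: big_ind => //; [apply: ideal0|apply: idealD]. Qed.

End Ideal.

Section Prime.
Hypothesis prI : prime_ideal I.

Lemma prime_is_ideal : ideal I. Proof. by case: prI. Qed.
Lemma prime1 : ~ I 1. Proof. by case: prI. Qed.
Lemma primeM a b : ~ I a -> ~ I b -> ~ I (a * b).
Proof. by case: prI => _ _ h Ia Ib /h[]. Qed.
Lemma primeMl a b : ~ I a -> I (a * b) -> I b.
Proof. by case: prI => _ _ h Ia /h[]. Qed.
Lemma primeX a n : ~ I a -> ~ I (a ^+ n).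
Proof.
move=> Ia; elim: n => [|n IH]; first by rewrite expr0; apply: prime1.
by rewrite exprS; apply: primeM.
Qed.
Lemma prime_prod (J : Type) (r : seq J) (p : pred J) (F : J -> A) :
  (forall j, p j -> ~ I (F j)) -> ~ I (\prod_(j <- r | p j) F j).
Proof.
move=> IF; apply: (big_ind (fun a => ~ I a)) => //; first exact: prime1.
exact: primeM.
Qed.

End Prime.

Lemma maximal_prime : maximal_ideal I -> prime_ideal I.
Proof.
move=> [idI IT Imax]; split=> // [I1|a b Iab].
  by apply: IT; apply/seteqP; split=> // x _; rewrite -(mulr1 x); apply: idealMl.
pose J := [set x | exists i c, I i /\ x = i + c * a].
have idJ : ideal J.
  split; first by exists 0, 0; rewrite mul0r addr0; split=> //; apply: ideal0.
    move=> _ _ [i [c [Ii ->]]] [j [d [Ij ->]]]; exists (i + j), (c + d).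
    by split; [apply: idealD|ring].
  move=> x _ [i [c [Ii ->]]]; exists (x * i), (x * c).
  by split; [apply: idealMl|ring].
have IJ : I `<=` J by move=> i Ii; exists i, 0; rewrite mul0r addr0.
have [JI|JT] := Imax J idJ IJ.
  by left; rewrite -JI; exists 0, 1; rewrite mul1r add0r; split=> //; apply: ideal0.
have [i [c [Ii E]]] : J 1 by rewrite JT.
right; rewrite -(mul1r b) E mulrDl; apply: idealD => //; first exact: idealMr.
by rewrite -mulrA; apply: idealMl.
Qed.

End Ideals.

Lemma prime_preimage (A B : comNzRingType) (f : {rmorphism A -> B}) (I : set B) :
  prime_ideal I -> prime_ideal [set a | I (f a)].
Proof.
move=> prI; have idI := prime_is_ideal prI; split.
- split=> [|a b|a b] /=; rewrite ?rmorph0 ?rmorphD ?rmorphM.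
  + exact: ideal0.
  + exact: idealD.
  + exact: idealMl.
- by rewrite /= rmorph1; apply: prime1.
- by move=> a b /=; rewrite rmorphM; case: prI => _ _; apply.
Qed.

Lemma mpoly_alg_ind (k : comNzRingType) n (S : {mpoly k[n]} -> Prop) :
  (forall c, S c%:MP) -> (forall f g, S f -> S g -> S (f + g)) ->
  (forall f g, S f -> S g -> S (f * g)) -> (forall i, S 'X_i) -> forall f, S f.
Proof.
move=> SC SD SM SX; elim/mpolyind => [|c m f _ _ Sf]; first by rewrite -mpolyC0.
apply: SD => //; rewrite -mul_mpolyC; apply: (SM) => //.
rewrite mpolyXE_id; apply: (big_ind S) => [||i _]; [by rewrite -mpolyC1|exact: SM|].
by elim: (m i) => [|j IH]; rewrite ?expr0 -?mpolyC1 // exprS; apply: SM.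
Qed.

Section Nullstellensatz.
Variable k : closedFieldType.

(* The Jacobson property and the weak Nullstellensatz in one: closed points are
   ring morphisms to [k] that split the structure map [iota]. *)
Definition enough_points (R : comNzRingType) (iota : k -> R) : Prop :=
  forall (I : set R) (f : R), prime_ideal I -> ~ I f ->
  exists phi : {rmorphism R -> k},
    [/\ forall c, phi (iota c) = c, forall a, I a -> phi a = 0 & phi f != 0].

Lemma enough_points_field : enough_points (@id k).
Proof.
move=> I f prI nIf; exists (GRing.RMorphism.clone _ _ idfun _); split=> // [a Ia|].
  have [//|a0] := eqVneq a 0; case: (prime1 prI).
  by rewrite -(mulVf a0); apply: idealMl => //; apply: prime_is_ideal.
by apply: contra_notN nIf => /eqP /= ->; exact: (ideal0 (prime_is_ideal prI)).
Qed.

(** The prime is pulled back along [s] and the point found on [S] is composed with [r], so one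
    cancellation law suffices. *)
Lemma enough_points_retract (R S : comNzRingType) (iota : k -> R) (jota : k -> S)
    (r : {rmorphism R -> S}) (s : {rmorphism S -> R}) :
  cancel r s -> (forall c, r (iota c) = jota c) ->
  enough_points jota -> enough_points iota.
Proof.
move=> rK rj Sp I f prI nIf.
have nf : ~ [set a | I (s a)] (r f) by rewrite /= rK.
have [phi [phij phiI phif]] := Sp _ _ (prime_preimage s prI) nf.
exists (GRing.RMorphism.clone _ _ (phi \o r) _); split=> //= [c|a Ia].
  by rewrite rj phij.
by apply: phiI; rewrite /= rK.
Qed.

Section PolyPoints.
Variables (R : idomainType) (I : set {poly R}).
Hypothesis prI : prime_ideal I.

Let idI := prime_is_ideal prI.
Let p := [set a | I a%:P].
Let prp : prime_ideal p := prime_preimage polyC prI.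
Let idp := prime_is_ideal prp.
Let coefs_in (g : {poly R}) := forall i, p g`_i.

Let coefs_in_ideal : ideal coefs_in.
Proof.
split=> [i|a b Ha Hb i|a b Hb i]; first by rewrite coef0; apply: ideal0.
  by rewrite coefD; apply: idealD.
by rewrite coefM; apply: ideal_sum => // j _; apply: idealMl.
Qed.

Let coefs_inW g : coefs_in g -> I g.
Proof.
move=> Hg; rewrite -[g]coefK poly_def; apply: ideal_sum => // i _.
by rewrite -mul_polyC; apply: idealMr => //; apply: Hg.
Qed.

(* An element of least degree outside [p[X]] divides, up to a power of its
   leading coefficient and modulo [p[X]], every element of the ideal. *)
Let pseudo_generator (L : set {poly R}) g0 : ideal L -> coefs_in `<=` L ->
  L g0 -> ~ coefs_in g0 ->
  exists g, [/\ L g, ~ p (lead_coef g),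
    forall h, L h -> (size h < size g)%N -> coefs_in h &
    forall h, L h -> exists N q t,
      [/\ lead_coef g ^+ N *: h = q * g + t, coefs_in t & (size t < size g)%N]].
Proof.
move=> idL pL Lg0 ng0.
pose S d := `[< exists g, [/\ L g, ~ coefs_in g & size g = d] >].
have exS : exists d, S d by exists (size g0); apply/asboolP; exists g0.
case: (ex_minnP exS) => d /asboolP[g [Lg ng sg]] dmin.
have gmin h : L h -> (size h < size g)%N -> coefs_in h.
  move=> Lh hg; apply: contrapT => nh; suff : (size g <= size h)%N by rewrite leqNgt hg.
  by rewrite sg; apply: dmin; apply/asboolP; exists h.
have g0' : g != 0 by apply: contra_notN ng => /eqP ->; apply: ideal0.
have nlead : ~ p (lead_coef g).
  (* Otherwise dropping the leading term leaves an element of [L] of lower degree, which is in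
     [coefs_in] by minimality. *)
  move=> pl; apply: ng.
  have pm : coefs_in (lead_coef g *: 'X^((size g).-1)).
    by move=> i; rewrite coefZ; apply: idealMr.
  rewrite -(subrK (lead_coef g *: 'X^((size g).-1)) g).
  apply: (idealD coefs_in_ideal) => //.
  apply: gmin; first by apply: idealB => //; apply: pL.
  have sg0 : (0 < size g)%N by rewrite size_poly_gt0.
  rewrite -[X in (_ < X)%N](prednK sg0) ltnS; apply/leq_sizeP => j.
  rewrite leq_eqVlt coefB coefZ coefXn => /orP[/eqP <-|jg].
    by rewrite eqxx mulr1 subrr.
  rewrite (gtn_eqF jg) mulr0 subr0 nth_default //.
  by rewrite -(prednK sg0).
exists g; split=> // h Lh.
exists (Pdiv.Ring.rscalp h g), (Pdiv.Ring.rdivp h g), (Pdiv.Ring.rmodp h g).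
have E := Pdiv.ComRing.rdivp_eq g h.
have sm : (size (Pdiv.Ring.rmodp h g) < size g)%N by rewrite Pdiv.Ring.ltn_rmodp.
split=> //; apply: gmin => //.
have -> : Pdiv.Ring.rmodp h g = lead_coef g ^+ Pdiv.Ring.rscalp h g *: h
    - Pdiv.Ring.rdivp h g * g by rewrite E addrC addKr.
by apply: idealB => //; [rewrite -mul_polyC|]; apply: idealMl.
Qed.

Let eval (phi : {rmorphism R -> k}) (c : k) : {rmorphism {poly R} -> k} :=
  GRing.RMorphism.clone _ _ (horner_eval c \o map_poly phi) _.

Let evalE phi c h : eval phi c h = (map_poly phi h).[c]. Proof. by []. Qed.

Let eval_coefs (phi : {rmorphism R -> k}) c h :
  (forall a, p a -> phi a = 0) -> coefs_in h -> eval phi c h = 0.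
Proof.
move=> phip ph; rewrite evalE; suff -> : map_poly phi h = 0 by rewrite horner0.
by apply/polyP => i; rewrite coef_map coef0; apply/phip/ph.
Qed.

(** A point of [R] killing the contraction [p] is extended by a value [c] of the variable. If [I] is
    just [p[X]], any non-root of the specialized [f] will do. Otherwise [c] is a root of a
    pseudo-generator [g] of [I], and the point of [R] avoids the leading coefficient of [g] and a
    constant lying in [I + (f)]. *)
Lemma poly_point (iota : k -> R) (f : {poly R}) : enough_points iota -> ~ I f ->
  exists phi : {rmorphism {poly R} -> k},
    [/\ forall c, phi (iota c)%:P = c, forall a, I a -> phi a = 0 & phi f != 0].
Proof.
move=> Rp nIf.
have [Ip|/existsNP[g0 /not_implyP[Ig0 ng0]]] := pselect (I `<=` coefs_in).
  have /existsNP[i nfi] : ~ coefs_in f by move=> /coefs_inW.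
  have [phi [phii phip phif]] := Rp p f`_i prp nfi.
  have /closed_nonrootP[c fc] : map_poly phi f != 0.
    by apply: contraNneq phif => f0; rewrite -coef_map f0 coef0.
  exists (eval phi c); split=> // [x|a /Ip pa]; last exact: eval_coefs.
  by rewrite evalE map_polyC hornerC /= phii.
have [g [Ig ng gmin gdiv]] := pseudo_generator idI coefs_inW Ig0 ng0.
pose L := [set h | exists u v, I v /\ h = u * f + v].
have IL : I `<=` L by move=> h Ih; exists 0, h; rewrite mul0r add0r.
have idL : ideal L.
  split; first by apply: IL; apply: ideal0.
    move=> _ _ [u [v [Iv ->]]] [u' [v' [Iv' ->]]]; exists (u + u'), (v + v').
    by split; [apply: idealD|ring].
  move=> x _ [u [v [Iv ->]]]; exists (x * u), (x * v).
  by split; [apply: idealMl|ring].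
have Lf : L f by exists 1, 0; rewrite mul1r addr0; split=> //; apply: ideal0.
have nf : ~ coefs_in f by move=> /coefs_inW.
have pL : coefs_in `<=` L by move=> h /coefs_inW /IL.
have [s [Ls ns smin sdiv]] := pseudo_generator idL pL Lf nf.
(* Pseudo-division of [f] by [s] would otherwise put into [I] a multiple of [f] by an element
   outside [p]. *)
have nIs : ~ I s.
  move=> Is; have [N [q [t [E pt _]]]] := sdiv f Lf; apply: nIf.
  have : I (lead_coef s ^+ N *: f).
    by rewrite E; apply: idealD => //; [apply: idealMl|apply: coefs_inW].
  rewrite -mul_polyC; apply: primeMl => //.
  exact: (primeX prp ns).
have sg : (size s <= size g)%N.
  rewrite leqNgt; apply/negP => /(smin _ (IL _ Ig)) pg; apply: ng; exact: pg.
(* If [s] had positive degree, pseudo-dividing [g] by [s] would give a quotient in [I] of lower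
   degree than [g], hence in [p[X]], and the leading coefficient of [g] would fall into [p]. *)
have ss : (size s <= 1)%N.
  rewrite leqNgt; apply/negP => s1.
  have [N [q [t [E pt ts]]]] := sdiv g (IL _ Ig).
  have Iqs : I (q * s).
    have -> : q * s = lead_coef s ^+ N *: g - t by rewrite E addrK.
    by apply: (idealB idI); [rewrite -mul_polyC; apply: (idealMl idI)|apply: coefs_inW].
  have Iq : I q by move: Iqs; rewrite mulrC; apply: primeMl.
  have pq : coefs_in q.
    have [->|q0] := eqVneq q 0; first exact: ideal0.
    apply: gmin => //.
    have s0 : s != 0 by rewrite -size_poly_gt0 (ltn_trans _ s1).
    have : (size (q * s)%R <= size g)%N.
      have -> : q * s = lead_coef s ^+ N *: g - t by rewrite E addrK.
      rewrite (leq_trans (size_polyD _ _)) // geq_max size_scale_leq size_polyN.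
      exact: ltnW (leq_trans ts sg).
    rewrite size_mul // => le1; apply: leq_trans le1.
    by case: (size s) s1 => [|[|m]] // _; rewrite !addnS /= ltnS leq_addr.
  have : p (lead_coef s ^+ N * lead_coef g).
    have pqs : coefs_in (q * s + t).
      by apply: (idealD coefs_in_ideal) => //; apply: (idealMr coefs_in_ideal).
    by rewrite [lead_coef g]lead_coefE -coefZ E.
  exact: (primeM prp (primeX prp ns)).
have [a sE] : exists a, s = a%:P by exists s`_0; apply: size1_polyC.
have pa : ~ p a by move: ns; rewrite sE lead_coefC.
have [phi [phii phip]] := Rp _ _ prp (primeM prp ng pa).
rewrite rmorphM mulf_eq0 negb_or => /andP[phig phia].
have g2 : (1 < size g)%N.
  rewrite ltnNge; apply/negP => /size1_polyC gE; apply: ng.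
  by rewrite gE lead_coefC /p /= -gE.
(* The degree of [g] survives [phi], since its leading coefficient does. *)
have [c /rootP gc] : exists c, root (map_poly phi g) c.
  apply/closed_rootP; rewrite size_poly_eq ?neq_ltn ?g2 ?orbT //.
have psiI h : I h -> eval phi c h = 0.
  move=> /gdiv[N [q [t [E pt _]]]].
  have /eqP : eval phi c (lead_coef g ^+ N *: h) = 0.
    by rewrite E rmorphD rmorphM [eval _ _ g]evalE gc mulr0 add0r; apply: eval_coefs.
  rewrite evalE linearZ_LR /= hornerZ mulf_eq0 rmorphXn expf_eq0 (negbTE phig) andbF /=.
  by move=> /eqP.
exists (eval phi c); split=> // [x|].
  by rewrite evalE map_polyC hornerC /= phii.
apply: contraNneq phia => f0; have [u [v [Iv E]]] := Ls.
have : eval phi c s = 0 by rewrite E rmorphD rmorphM f0 mulr0 add0r psiI.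
by rewrite sE evalE map_polyC hornerC => ->.
Qed.

End PolyPoints.

(** Induction on [n]: the last variable is split off as the indeterminate of a univariate polynomial
    ring, to which [poly_point] applies. *)
Lemma enough_points_mpoly n : enough_points (fun c => c%:A : {mpoly k[n]}).
Proof.
have algC (m : nat) c : c%:A = c%:MP :> {mpoly k[m]} by rewrite alg_mpolyC.
elim: n => [|n IH].
  pose r : {rmorphism {mpoly k[0]} -> k} := GRing.RMorphism.clone _ _ (@mcoeff 0 k 0%MM) _.
  pose s : {rmorphism k -> {mpoly k[0]}} := GRing.RMorphism.clone _ _ (@mpolyC 0 k) _.
  apply: (enough_points_retract (r := r) (s := s) (jota := id)) => [f|c|].
  - by rewrite [RHS]nvar0_mpolyC.
  - by rewrite /= algC mcoeffC eqxx mulr1.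
  - exact: enough_points_field.
have sp : enough_points (fun c : k => (c%:A : {mpoly k[n]})%:P).
  by move=> I f prI nIf; apply: poly_point.
pose h (i : 'I_n.+1) : {poly {mpoly k[n]}} :=
  if unlift ord_max i is Some j then ('X_j)%:P else 'X.
pose r : {rmorphism {mpoly k[n.+1]} -> {poly {mpoly k[n]}}} :=
  GRing.RMorphism.clone _ _ (mmap (polyC \o @mpolyC n k) h) _.
pose s : {rmorphism {poly {mpoly k[n]}} -> {mpoly k[n.+1]}} :=
  GRing.RMorphism.clone _ _ (horner_eval 'X_ord_max \o map_poly (@mwiden n k)) _.
have rC c : r c%:MP = (c%:MP)%:P by rewrite /= mmapC.
have rX i : r 'X_i = h i by rewrite /= mmapX mmap1U.
have sC c : s (c%:MP)%:P = c%:MP.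
  by rewrite /= map_polyC /horner_eval hornerC /= mwidenC.
have sh i : s (h i) = 'X_i.
  rewrite /= /h /horner_eval; case: unliftP => [j|] ->.
    rewrite map_polyC hornerC /= mwidenX mnmwiden1; congr 'X__.
    by apply: val_inj; rewrite /= /bump leqNgt ltn_ord.
  by rewrite map_polyX hornerX.
(* The bodies of [r] and [s] are forgotten; only their values on constants and variables matter from
   here on. *)
move: r s rC rX sC sh => r s rC rX sC sh.
apply: (enough_points_retract (r := r) (s := s)) sp => [f|c]; last first.
  by rewrite !algC rC.
elim/mpoly_alg_ind: f => [c|f g rf rg|f g rf rg|i].
- by rewrite rC sC.
- by rewrite (rmorphD r) (rmorphD s) rf rg.
- by rewrite (rmorphM r) (rmorphM s) rf rg.
- by rewrite rX sh.
Qed.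

End Nullstellensatz.

(** * Cores of prime ideals under derivations *)

Section DerivationCore.
Variable A : comNzRingType.

Definition derivation (D : A -> A) : Prop :=
  (forall a b, D (a + b) = D a + D b) /\ (forall a b, D (a * b) = a * D b + b * D a).

(** The largest [D]-stable subset of [M]. *)
Definition core1 (D : A -> A) (M : set A) : set A := [set a | forall n, M (iter n D a)].

Section OneDerivation.
Variables (D : A -> A) (M : set A).
Hypothesis derD : derivation D.

Let DD a b : D (a + b) = D a + D b. Proof. by case: derD. Qed.
Let DM a b : D (a * b) = a * D b + b * D a. Proof. by case: derD. Qed.

Let iterDD n a b : iter n D (a + b) = iter n D a + iter n D b.
Proof. by elim: n a b => // n IH a b; rewrite !iterSr DD IH. Qed.

Lemma core1_sub : core1 D M `<=` M. Proof. by move=> a /(_ 0). Qed.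

Lemma core1_stable a : core1 D M a -> core1 D M (D a).
Proof. by move=> Ma n; rewrite -iterSr; apply: Ma. Qed.

Lemma core1_max (J : set A) :
  J `<=` M -> (forall a, J a -> J (D a)) -> J `<=` core1 D M.
Proof. by move=> JM JD a Ja n; apply: JM; elim: n => //= n; apply: JD. Qed.

Section IdealCore.
Hypothesis idM : ideal M.

Let iterM_in n a b : (forall i, (i <= n)%N -> M (iter i D b)) -> M (iter n D (a * b)).
Proof.
elim: n a b => [|n IH] a b Mb; first exact: (idealMl idM _ (Mb 0 _)).
rewrite iterSr DM iterDD mulrC; apply: (idealD idM).
  by rewrite mulrC; apply: IH => i iln; rewrite -iterSr; apply: Mb.
by rewrite mulrC; apply: IH => i iln; apply: Mb; apply: ltnW.
Qed.

(** In every other term of the Leibniz expansion, [a] is derived fewer than [r] times or [b] fewer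
    than [s] times. The double induction uses Pascal's rule and avoids the full formula. *)
Let iterM_lead r s a b : (forall i, (i < r)%N -> M (iter i D a)) ->
  (forall j, (j < s)%N -> M (iter j D b)) ->
  M (iter (r + s) D (a * b) - (iter r D a * iter s D b) *+ 'C(r + s, r)).
Proof.
elim: r s a b => [|r IHr].
  elim=> [|s IHs] a b Ma Mb; first by rewrite subrr; apply: ideal0.
  rewrite add0n iterSr DM iterDD bin0 mulr1n addrAC; apply: (idealD idM).
    have := IHs a (D b) Ma; rewrite add0n bin0 mulr1n -iterSr; apply=> j js.
    by rewrite -iterSr; apply: Mb.
  by rewrite mulrC; apply: iterM_in.
elim=> [|s IHs] a b Ma Mb.
  rewrite addn0 iterSr DM iterDD binn mulr1n -addrA; apply: (idealD idM).
    by rewrite mulrC; apply: iterM_in.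
  have := IHr 0 (D a) b; rewrite addn0 binn mulr1n /= -iterS iterSr [b * _]mulrC.
  by apply=> // i ir; rewrite -iterSr; apply: Ma.
have -> : (r.+1 + s.+1 = (r.+1 + s).+1)%N by rewrite addnS.
rewrite iterSr DM iterDD binS mulrnDr [b * _]mulrC.
rewrite opprD addrACA; apply: (idealD idM).
  rewrite [iter s.+1 D b]iterSr; apply: IHs => // j js.
  by rewrite -iterSr; apply: Mb.
rewrite [iter r.+1 D a]iterSr addSnnS; apply: IHr => // i ir.
by rewrite -iterSr; apply: Ma.
Qed.

Lemma core1_ideal : ideal (core1 D M).
Proof.
split=> [n|a b Ma Mb n|a b Mb n].
- elim: n => [|n IH]; first exact: ideal0.
  rewrite iterSr; suff -> : D 0 = 0 by [].
  by apply: (@addrI _ (D 0)); rewrite -DD !addr0.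
- by rewrite iterDD; apply: idealD.
- by apply: iterM_in.
Qed.

(* For least [r], [s] with [D^r a] and [D^s b] outside [M], the Leibniz
   expansion of [D^(r+s) (a b)] has a single term outside [M]. *)
Lemma core1_prime : (forall n, (0 < n)%N -> ~ M n%:R) ->
  prime_ideal M -> prime_ideal (core1 D M).
Proof.
move=> M_char0 prM; split; first exact: core1_ideal.
  by move=> /core1_sub; apply: prime1.
have least a : ~ core1 D M a ->
    exists r, ~ M (iter r D a) /\ forall i, (i < r)%N -> M (iter i D a).
  move=> /existsNP[r Mr].
  have ex : exists r, `[< ~ M (iter r D a) >] by exists r; apply/asboolP.
  case: (ex_minnP ex) => m /asboolP Mm mmin; exists m; split=> // i im.
  apply: contrapT => Mi; have : (m <= i)%N by apply: mmin; apply/asboolP.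
  by rewrite leqNgt im.
move=> a b Mab; apply: contrapT => /not_orP[/least[r [nr Mr]] /least[s [ns Ms]]].
have /(idealBl idM)/(_ (Mab _)) := iterM_lead Mr Ms.
rewrite -mulr_natr; apply: (primeM prM); first exact: primeM.
by apply: M_char0; rewrite bin_gt0 leq_addr.
Qed.

End IdealCore.
End OneDerivation.

Section ManyDerivations.
Variables (m : nat) (D : 'I_m -> A -> A) (M : set A).
Hypothesis derD : forall i, derivation (D i).

Let round (s : seq 'I_m) (I : set A) := foldr (fun i => core1 (D i)) I s.
Let tower j := iter j (round (enum 'I_m)) M.

(* Taking the cores for the single derivations in turn, over and over, gives a
   descending chain of primes; its intersection is prime and stable under all
   the derivations. *)
Lemma differential_core :
  (forall n, (0 < n)%N -> ~ M n%:R) -> prime_ideal M ->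
  exists N, [/\ prime_ideal N, N `<=` M, forall i a, N a -> N (D i a) &
    forall J, J `<=` M -> (forall i a, J a -> J (D i a)) -> J `<=` N].
Proof.
move=> M_char0 prM.
have round_sub s I : round s I `<=` I.
  by elim: s => //= i s IH a /core1_sub; apply: IH.
have round_prime s I : I `<=` M -> prime_ideal I -> prime_ideal (round s I).
  move=> IM prI; elim: s => //= i s IH; apply: core1_prime => //.
    exact: prime_is_ideal.
  by move=> n n0 /round_sub/IM; apply: M_char0.
(* A round need not be stable under [D i]; it is only mapped into the previous stage, which is
   enough for the intersection of all stages. *)
have round_D s I i a : i \in s -> round s I a -> I (D i a).
  elim: s => //= j s IH; rewrite inE => /orP[/eqP ->|si]; last first.
    by move/core1_sub; apply: IH.
  by move/core1_stable/core1_sub/round_sub.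
have round_max s I J : J `<=` I -> (forall i a, J a -> J (D i a)) -> J `<=` round s I.
  by move=> JI JD; elim: s => //= i s IH; apply: core1_max => // a; apply: JD.
have tower_sub j l : (j <= l)%N -> tower l `<=` tower j.
  move=> /subnK <-; elim: (l - j)%N => // d IH a.
  by rewrite addSn => /round_sub; apply: IH.
have tower_prime j : prime_ideal (tower j).
  by elim: j => //= j; apply: round_prime; apply: (tower_sub 0%N).
pose N := [set a | forall j, tower j a].
exists N; split.
- split=> [|/(_ 0)|a b Nab]; last 2 first.
  + exact: prime1.
  + apply: contrapT => /not_orP[/existsNP[i ni] /existsNP[j nj]].
    (* The tower descends, so both factors are still missing at the later of the two stages. *)
    have {Nab} := Nab (maxn i j); apply: (primeM (tower_prime _)).
      by move/(tower_sub i); apply: contra_not ni; apply; apply: leq_maxl.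
    by move/(tower_sub j); apply: contra_not nj; apply; apply: leq_maxr.
  split=> [j|a b Na Nb j|a b Nb j].
  + exact: (ideal0 (prime_is_ideal (tower_prime j))).
  + by apply: (idealD (prime_is_ideal (tower_prime j))); [apply: Na|apply: Nb].
  + by apply: (idealMl (prime_is_ideal (tower_prime j))); apply: Nb.
- by move=> a /(_ 0).
- move=> i a Na j; apply: (round_D (enum 'I_m)); first by rewrite mem_enum.
  exact: (Na j.+1).
- move=> J JM JD a Ja j; elim: j a Ja => [|j IH] a Ja; first exact: JM.
  exact: round_max JD _ Ja.
Qed.

End ManyDerivations.
End DerivationCore.

(** * Poisson algebras *)

Lemma fraction_div (D : idomainType) (u : {fraction D}) :
  exists x y, y != 0 /\ u = FracField.tofrac x / FracField.tofrac y.
Proof.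
exists (frac (repr u)).1, (frac (repr u)).2; rewrite denom_ratioP; split=> //.
rewrite -{1}[u]reprK; move: (repr u) => r; rewrite -{1}[r]Ratio_numden.
unlock FracField.tofrac.
rewrite -[_^-1]FracField.pi_inv -[RHS]FracField.pi_mul.
rewrite /FracField.invf /FracField.mulf.
by rewrite !numden_Ratio ?oner_neq0 ?denom_ratioP // mulr1 mul1r.
Qed.

(** An annihilating polynomial splits over [k], and one of its linear factors vanishes at [u]. *)
Lemma algebraicOver_closed (k : closedFieldType) (E : fieldType)
    (iota : {rmorphism k -> E}) u :
  algebraicOver iota u -> exists c, u = iota c.
Proof.
case=> p p0; have [s ps] := closed_field_poly_normal p.
rewrite ps map_polyZ /= rootZ ?fmorph_eq0 ?lead_coef_eq0 //.
rewrite rmorph_prod /= => /rootP; rewrite horner_prod => /eqP.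
rewrite prodf_seq_eq0 => /hasP[c _] /=.
rewrite rmorphB /= map_polyX map_polyC !hornerE subr_eq0 => /eqP ->.
by exists c.
Qed.

Section PoissonTheory.
Variables (k : closedFieldType) (A : comAlgType k) (br : A -> A -> A).
Hypothesis pb : poisson_bracket br.

Lemma pbDl a b c : br (a + b) c = br a c + br b c.
Proof. by have := pb_linl pb c 1 a b; rewrite !scale1r. Qed.

Lemma pbC a b : br b a = - br a b.
Proof.
have brDr a' b' c : br c (a' + b') = br c a' + br c b'.
  by have := pb_linr pb c 1 a' b'; rewrite !scale1r.
have := pb_alt pb (a + b); rewrite pbDl !brDr !(pb_alt pb) add0r addr0.
by move/eqP; rewrite addrC addr_eq0 => /eqP.
Qed.

Lemma pbDr a b c : br c (a + b) = br c a + br c b.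
Proof. by rewrite ![br c _]pbC pbDl opprD. Qed.

Lemma pb0l a : br 0 a = 0.
Proof. by apply: (@addrI _ (br 0 a)); rewrite -pbDl !addr0. Qed.

Lemma pbNl a c : br (- a) c = - br a c.
Proof. by apply/eqP; rewrite -addr_eq0 -pbDl addNr pb0l. Qed.

Lemma pbBl a b c : br (a - b) c = br a c - br b c.
Proof. by rewrite pbDl pbNl. Qed.

Lemma pbZl x a c : br (x *: a) c = x *: br a c.
Proof. by have := pb_linl pb c x a 0; rewrite pb0l !addr0. Qed.

Lemma pbZr x a c : br c (x *: a) = x *: br c a.
Proof. by rewrite ![br c _]pbC pbZl scalerN. Qed.

Lemma pbMl a b c : br (a * b) c = a * br b c + b * br a c.
Proof. exact: (pb_leibniz pb). Qed.

Lemma pbMr a b c : br c (a * b) = a * br c b + b * br c a.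
Proof. by rewrite ![br c _]pbC pbMl opprD !mulrN. Qed.

Lemma pb1l a : br 1 a = 0.
Proof. by apply: (@addrI _ (br 1 a)); rewrite addr0 -{3}(mulr1 1) pbMl !mul1r. Qed.

Lemma pb_scalarr x a : br a x%:A = 0.
Proof. by rewrite pbZr pbC pb1l oppr0 scaler0. Qed.

(* The fraction [a / b] of the domain [A / I] is Poisson central. *)
Definition central_pair (I : set A) (a b : A) : Prop :=
  forall c, I (b * br a c - a * br b c).

(** Rationality without quotient fields: over an algebraically closed [k], a central fraction is
    algebraic only if it is a scalar. *)
Definition only_scalar_casimirs (I : set A) : Prop :=
  forall a b, ~ I b -> central_pair I a b -> exists c, I (a - c *: b).

Section Rational.
Variable I : set A.
Hypothesis ppI : prime_poisson_ideal br I.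

Section Quotient.
Variable primeI : prime_ideal I.
Local Notation D := (prime_quot primeI).
Local Notation pi := (\pi_D%qT).
Local Notation tofrac := (@FracField.tofrac D).
Local Notation qbr := (@quot_bracket A I primeI br).

Let pi_eq0 a : pi a = 0 <-> I a.
Proof.
rewrite -(rmorph0 pi) -[in I a](subr0 a).
by split=> [/eqmodP /asboolP //|Ia]; apply/eqmodP; apply/asboolP.
Qed.

Let qbr_pi a b : qbr (pi a) (pi b) = pi (br a b).
Proof.
apply: quot_bracket_pi; first by case: ppI.
  by move=> c x y; apply: pbBl.
exact: pbC.
Qed.

Let qbrC u v : qbr v u = - qbr u v.
Proof. by rewrite -[u]reprK -[v]reprK !qbr_pi pbC rmorphN. Qed.

Let qbrM u v w : qbr (u * v) w = u * qbr v w + v * qbr u w.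
Proof.
rewrite -[u]reprK -[v]reprK -[w]reprK -rmorphM !qbr_pi pbMl.
by rewrite rmorphD !rmorphM.
Qed.

Let frac_pi u : exists a b, ~ I b /\ u = tofrac (pi a) / tofrac (pi b).
Proof.
have [x [y [y0 ->]]] := fraction_div u; exists (repr x), (repr y).
by rewrite !reprK; split=> // /pi_eq0; rewrite reprK; apply/eqP.
Qed.

Let nz_pi b : ~ I b -> pi b != 0.
Proof. by move=> nb; apply/eqP => /pi_eq0. Qed.

(** The numerator of the bracket of [a / b] with [c / d] combines the central-pair expressions at
    [c] and [d]; conversely, [d = 1] isolates the one at [c]. *)
Let central_pairP a b : ~ I b ->
  central_pair I a b <-> poisson_center_frac qbr (tofrac (pi a) / tofrac (pi b)).
Proof.
move=> nb; have b0 := nz_pi nb; split=> [ab v|ab c].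
  have [c [d [nd ->]]] := frac_pi v; have d0 := nz_pi nd.
  rewrite (frac_bracket_div _ _ qbrC qbrM b0 d0) !qbr_pi.
  set N := (X in FracField.tofrac X / _); suff -> : N = 0 by rewrite rmorph0 mul0r.
  rewrite /N -!(rmorphM pi) -!(rmorphB pi) -(rmorphD pi).
  apply/pi_eq0; have idI := prime_is_ideal primeI.
  have -> : br a c * (b * d) - br a d * (b * c) - br b c * (a * d) + br b d * (a * c)
    = d * (b * br a c - a * br b c) - c * (b * br a d - a * br b d) by ring.
  by apply: (idealB idI); apply: (idealMl idI); apply: ab.
have n1 := nz_pi (prime1 primeI).
have := ab (tofrac (pi c) / tofrac (pi 1)).
rewrite (frac_bracket_div _ _ qbrC qbrM b0 n1) !qbr_pi.
move/eqP; rewrite mulf_eq0 invr_eq0 !tofrac_eq0 expf_eq0 /= mulf_eq0.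
rewrite (negbTE b0) (negbTE n1) !orbF.
rewrite -!(rmorphM pi) -!(rmorphB pi) -(rmorphD pi) => /eqP/pi_eq0.
rewrite [br a 1]pbC [br b 1]pbC !pb1l !oppr0 !mul0r subr0 addr0 !mulr1.
by rewrite [b * _]mulrC [a * _]mulrC.
Qed.

Let scalar : {rmorphism k -> {fraction D}} :=
  GRing.RMorphism.clone _ _ (tofrac \o (pi \o in_alg A)) _.

Let fracE a b c : ~ I b -> tofrac (pi a) / tofrac (pi b) = scalar c <-> I (a - c *: b).
Proof.
move=> nb; have b0 : tofrac (pi b) != 0 by rewrite tofrac_eq0 nz_pi.
have <- : tofrac (pi (a - c *: b)) = 0 <-> I (a - c *: b).
  by rewrite -(rmorph0 tofrac) -pi_eq0; split=> [/eqP|->//]; rewrite tofrac_eq => /eqP.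
have -> : tofrac (pi (a - c *: b)) = tofrac (pi a) - scalar c * tofrac (pi b).
  by rewrite -(rmorphM tofrac) -(rmorphM pi) mulr_algl (rmorphB pi) (rmorphB tofrac).
split=> [<-|/eqP]; first by rewrite divfK // subrr.
by rewrite subr_eq0 => /eqP ->; rewrite mulfK.
Qed.

Lemma rational_quotP :
  (forall u, poisson_center_frac qbr u -> algebraicOver (scalar_frac primeI) u)
  <-> only_scalar_casimirs I.
Proof.
split=> [alg a b nb /(central_pairP _ nb) /alg|sc u uc].
  by move=> /(@algebraicOver_closed _ _ scalar)[c /fracE]; exists c; auto.
have [a [b [nb uE]]] := frac_pi u.
move: uc; rewrite uE => /(central_pairP _ nb) /(sc _ _ nb)[c /(fracE _ _ nb) ->].
exact: (algebraic_id scalar).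
Qed.

End Quotient.

Lemma rationalP : rational br I <-> only_scalar_casimirs I.
Proof.
split=> [[_ [primeI /rational_quotP]] //|sc]; split=> //.
by have [prI _] := ppI; exists prI; apply/rational_quotP.
Qed.

End Rational.
End PoissonTheory.

(** * Symplectic ideals of polynomial Poisson algebras *)

Section PolynomialPoisson.
Variables (k : closedFieldType) (m : nat).
Local Notation A := {mpoly k[m]}.
Variable br : A -> A -> A.
Hypothesis char0 : [pchar k] =i pred0.
Hypothesis pb : poisson_bracket br.

Lemma kernel_maximal (phi : {rmorphism A -> k}) :
  (forall c, phi c%:A = c) -> maximal_ideal [set a | phi a = 0].
Proof.
move=> phiC; split.
- split=> [|a b /= Ha Hb|a b /= Hb]; rewrite /= ?rmorph0 //.
    by rewrite rmorphD Ha Hb addr0.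
  by rewrite rmorphM Hb mulr0.
- move=> E; have : [set a | phi a = 0] 1 by rewrite E.
  by move=> /eqP; rewrite rmorph1 oner_eq0.
- move=> J idJ MJ.
  have [JM|/existsNP[a /not_implyP[Ja a0]]] := pselect (J `<=` [set a | phi a = 0]).
    by left; apply/seteqP.
  right; apply/seteqP; split=> // b _.
  have phia : phi a != 0 by apply/eqP.
  (* The quotient by the kernel is [k], where [phi a] is invertible. *)
  have H : J (b - (phi b / phi a)%:A * a).
    by apply: MJ; rewrite /= rmorphB rmorphM phiC divfK // subrr.
  by apply: (idealBr idJ H); apply: idealMl.
Qed.

(** The kernel of a closed point killing [M] contains [M], hence equals it by maximality. *)
Lemma maximal_kernel M : maximal_ideal M -> exists phi : {rmorphism A -> k},
  (forall c, phi c%:A = c) /\ forall a, M a <-> phi a = 0.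
Proof.
move=> maxM; have prM := maximal_prime maxM.
have [phi [phiC phiM _]] := enough_points_mpoly prM (prime1 prM).
exists phi; split=> // a; split=> [/phiM//|]; have [_ _ Mmax] := maxM.
have [idK KT _] := kernel_maximal phiC.
by have [<- //|/KT] := Mmax _ idK phiM.
Qed.

(** By the Leibniz rule an ideal is Poisson once it is stable under bracketing with the variables,
    so this is the differential core for finitely many derivations. *)
Lemma poisson_core M : prime_ideal M ->
  exists N, [/\ prime_poisson_ideal br N, N `<=` M &
    forall J, poisson_ideal br J -> J `<=` M -> J `<=` N].
Proof.
move=> prM.
have der (i : 'I_m) : derivation (fun a : A => br a 'X_i).
  by split=> a b; [apply: pbDl|apply: pbMl].
have M_char0 n : (0 < n)%N -> ~ M n%:R.
  move=> n0 Mn; apply: (prime1 prM).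
  have nz : n%:R != 0 :> k by rewrite ((pcharf0P k).1 char0) -lt0n.
  have -> : 1 = (n%:R^-1)%:A * n%:R :> A
    by rewrite mulr_algl -scaler_nat scalerA mulVf ?scale1r.
  by apply: idealMl => //; apply: prime_is_ideal.
have [N [prN NM ND Nmax]] := differential_core der M_char0 prM.
have idN := prime_is_ideal prN.
exists N; split=> // [|J [_ JD] JM]; last by apply: Nmax => // i a; apply: JD.
split=> //; split=> // a b; move: b a; apply: mpoly_alg_ind.
- by move=> c a Na; rewrite -alg_mpolyC (pb_scalarr pb); apply: ideal0.
- by move=> f g Hf Hg a Na; rewrite (pbDr pb); apply: idealD => //; [apply: Hf|apply: Hg].
- move=> f g Hf Hg a Na; rewrite (pbMr pb).
  by apply: idealD => //; apply: idealMl => //; [apply: Hg|apply: Hf].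
- by move=> i a; apply: ND.
Qed.

(** The largest Poisson ideal inside [M] is unique, and [poisson_core] supplies one that is
    prime. *)
Lemma symp_prime N : symp br N -> prime_poisson_ideal br N.
Proof.
move=> [M [maxM pN NM Nmax]].
have [N' [ppN' N'M N'max]] := poisson_core (maximal_prime maxM).
have -> // : N = N'; apply/seteqP; split; first exact: N'max.
by apply: Nmax => //; case: ppN'.
Qed.

(** Some [f] outside [N] lies in all Poisson primes strictly above [N]. At a closed point of [N]
    where [f] does not vanish, the core contains [N] but not [f], so it is [N]. *)
Lemma locally_closed_symp N : locally_closed br N -> symp br N.
Proof.
move=> [ppN [_ /existsNP[f /not_implyP[fJ Nf]]]].
have [phi [phiC phiN phif]] := enough_points_mpoly (proj1 ppN) Nf.
pose M := [set a | phi a = 0]; have maxM : maximal_ideal M by apply: kernel_maximal.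
have [N' [ppN' N'M N'max]] := poisson_core (maximal_prime maxM).
have NN' : N `<=` N' by apply: N'max => //; case: ppN.
have N'N : N' `<=` N.
  apply: contrapT => N'N; case/eqP: phif; apply: N'M; exact: fJ.
exists M; split=> // [|J pJ JM]; first by case: ppN.
by apply: subset_trans N'N; apply: N'max.
Qed.

(* The denominators of a central fraction form a nonzero Poisson ideal, hence
   one of them is nonzero at the chosen closed point. *)
Lemma symp_casimirs N : symp br N -> only_scalar_casimirs br N.
Proof.
move=> sN; have [prN [idN ND]] := symp_prime sN.
move: sN => [M [/maximal_kernel[phi [phiC MP]] _ NM Nmax]].
have regular a b : ~ N b -> central_pair br N a b ->
    exists f h, phi f != 0 /\ N (f * a - h * b).
  move=> nb ab; pose Den := [set f | exists h, N (f * a - h * b)].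
  suff : ~ Den `<=` M.
    by move=> /existsNP[f /not_implyP[[h fh] /MP/eqP nf]]; exists f, h.
  have pDen : poisson_ideal br Den.
    split; first split.
    - by exists 0; rewrite !mul0r subr0; apply: ideal0.
    - move=> f f' [h fh] [h' fh']; exists (h + h').
      by rewrite !mulrDl opprD addrACA; apply: idealD.
    - by move=> x f [h fh]; exists (x * h); rewrite -!mulrA -mulrBr; apply: idealMl.
    (* If [f * (a / b)] is [h] modulo [N], bracketing with [c] gives [br f c * (a / b) = br h c],
       because [a / b] is central. *)
    - move=> f c [h fh]; exists (br h c); apply: (primeMl prN nb).
      have -> : b * (br f c * a - br h c * b) =
          b * br (f * a - h * b) c - (f * (b * br a c - a * br b c)
             + (f * a - h * b) * br b c).
        by rewrite (pbBl pb) !(pbMl pb); ring.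
      apply: (idealB idN); first by apply: idealMl => //; apply: ND.
      by apply: (idealD idN); [apply: idealMl|apply: idealMr].
  (* [b] is itself a denominator, with numerator [a]. *)
  move=> DM; apply: nb; apply: (Nmax _ pDen DM).
  by exists a; rewrite mulrC subrr; apply: ideal0.
move=> a b nb ab; have [f [h [phif fh]]] := regular a b nb ab.
(* [c] is the value of [a / b] at [M]. *)
pose c := phi h / phi f; exists c; apply: contrapT => na'.
have ca' : central_pair br N b (a - c *: b).
  move=> d; rewrite (pbBl pb) (pbZl pb).
  have -> : (a - c *: b) * br b d - b * (br a d - c *: br b d)
    = - (b * br a d - a * br b d) by rewrite -!mul_mpolyC; ring.
  exact: idealN.
have [f' [h' [phif' fh']]] := regular _ _ na' ca'.
(* The fractions [(h - c *: f) / f] and [h' / f'] are inverse to each other modulo [N]; at [M] the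
   product [f * f'] is nonzero while [h - c *: f] vanishes. *)
have : N ((a - c *: b) * (f * f' - (h - c *: f) * h')).
  have -> : (a - c *: b) * (f * f' - (h - c *: f) * h')
    = f' * (f * a - h * b) + (h - c *: f) * (f' * b - h' * (a - c *: b)).
    by rewrite -!mul_mpolyC; ring.
  by apply: (idealD idN); apply: idealMl.
move/(primeMl prN na')/NM/MP/eqP; apply/negP.
rewrite rmorphB !rmorphM rmorphB -mulr_algl rmorphM phiC divfK // subrr mul0r subr0.
by rewrite mulf_neq0.
Qed.

End PolynomialPoisson.

(** * Semi-invariant elements *)

Section SemiInvariants.
Variables (k : closedFieldType) (A : comAlgType k) (br : A -> A -> A).
Hypothesis pb : poisson_bracket br.
Variables I J U : set A.
Hypotheses (ppI : prime_poisson_ideal br I) (ppJ : prime_poisson_ideal br J).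
Hypothesis IJ : I `<=` J.

Let prI : prime_ideal I := proj1 ppI.
Let idI := prime_is_ideal prI.
Let prJ : prime_ideal J := proj1 ppJ.
Let idJ := prime_is_ideal prJ.

Let ZI (K : set A) (idK : ideal K) c a : K a -> K (c *: a).
Proof. by rewrite -mulr_algl; apply: idealMl. Qed.

Let scaleE c (a : A) : c *: a = in_alg A c * a.
Proof. by rewrite /= mulr_algl. Qed.

Definition log_mod (u v : A) : Prop := exists c : k, I (br u v - c *: (u * v)).

Lemma log_mod0l u v : I u -> log_mod u v.
Proof. by move=> Iu; exists 0; rewrite scale0r subr0; case: ppI => _ [_]; apply. Qed.

Lemma log_modC u v : log_mod u v -> log_mod v u.
Proof.
move=> [c H]; exists (- c); rewrite (pbC pb) scaleNr -opprD mulrC.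
exact: idealN.
Qed.

Lemma log_modP c u v : br u v = c *: (u * v) -> log_mod u v.
Proof. by move=> E; exists c; rewrite E subrr; apply: ideal0. Qed.

Lemma log_modM u v w : log_mod u v -> log_mod u w -> log_mod u (v * w).
Proof.
move=> [c Hc] [d Hd]; exists (c + d); rewrite (pbMr pb).
have -> : v * br u w + w * br u v - (c + d) *: (u * (v * w))
  = v * (br u w - d *: (u * w)) + w * (br u v - c *: (u * v)).
  rewrite !mulrBr -!scalerAr scalerDl (mulrCA v u w) (mulrCA w u v) (mulrC w v).
  by rewrite opprD (addrC (- _)) addrACA.
by apply: (idealD idI); apply: idealMl.
Qed.

Lemma log_modZ u v c : log_mod u v -> log_mod u (c *: v).
Proof.
move=> [d Hd]; exists d; rewrite (pbZr pb) -scalerAr !scalerA mulrC -scalerA -scalerBr.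
exact: ZI.
Qed.

(** Outside [J], not merely outside [I]: a nonzero multiple of such an element in [J] is the
    contradiction that ends [semi_sum_in]. *)
Definition semi_invariant : set A := [set w | ~ J w /\ forall u, U u -> log_mod u w].

Lemma semi_invariant1 : semi_invariant 1.
Proof.
split; first exact: prime1.
move=> u _; exists 0; rewrite (pbC pb) (pb1l pb) oppr0 scale0r subr0.
exact: ideal0.
Qed.

Lemma semi_invariantM v w : semi_invariant v -> semi_invariant w -> semi_invariant (v * w).
Proof.
move=> [nv Uv] [nw Uw]; split; first exact: primeM.
by move=> u Uu; apply: log_modM; [apply: Uv|apply: Uw].
Qed.

Lemma semi_invariantZ c w : c != 0 -> semi_invariant w -> semi_invariant (c *: w).
Proof.
move=> c0 [nw Uw]; split; last by move=> u Uu; apply: log_modZ; apply: Uw.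
by move=> /(ZI idJ c^-1); rewrite scalerA mulVf // scale1r.
Qed.

Hypothesis U_semi : forall u, U u -> I u \/ semi_invariant u.

(** Modulo [I], [g] is a sum of semi-invariants with denominator [w]. Coefficients are absorbed into
    the terms, since nonzero multiples of semi-invariants are semi-invariant. *)
Definition semi_spanned (g : A) : Prop := exists w s,
  [/\ semi_invariant w, forall v, v \in s -> semi_invariant v &
      I (w * g - \sum_(v <- s) v)].

Lemma semi_spannedC c : semi_spanned c%:A.
Proof.
(* Zero lies in [J], so it is not semi-invariant and needs the empty sum. *)
have [->|c0] := eqVneq c 0.
  exists 1, [::]; rewrite scale0r mulr0 big_nil subrr; split=> //.
    exact: semi_invariant1.
  exact: ideal0.
exists 1, [:: c%:A]; rewrite big_seq1 mul1r subrr; split.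
- exact: semi_invariant1.
- by move=> v; rewrite inE => /eqP ->; apply: semi_invariantZ => //; apply: semi_invariant1.
- exact: ideal0.
Qed.

Lemma semi_spannedU u : U u -> semi_spanned u.
Proof.
move=> /U_semi[Iu|su].
  exists 1, [::]; rewrite big_nil mul1r subr0; split=> //; exact: semi_invariant1.
exists 1, [:: u]; rewrite big_seq1 mul1r subrr; split; last exact: ideal0.
  exact: semi_invariant1.
by move=> v; rewrite inE => /eqP ->.
Qed.

Lemma semi_spannedD f g : semi_spanned f -> semi_spanned g -> semi_spanned (f + g).
Proof.
move=> [v [s [sv ss Is]]] [w [t [sw st It]]].
exists (v * w), ([seq w * a | a <- s] ++ [seq v * a | a <- t]); split.
- exact: semi_invariantM.
- move=> a; rewrite mem_cat => /orP[]/mapP[b bs ->]; apply: semi_invariantM => //.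
    exact: ss.
  exact: st.
rewrite big_cat !big_map /= -!mulr_sumr.
have -> : v * w * (f + g) - (w * \sum_(i <- s) i + v * \sum_(i <- t) i)
  = w * (v * f - \sum_(i <- s) i) + v * (w * g - \sum_(i <- t) i) by ring.
by apply: (idealD idI); apply: idealMl.
Qed.

Lemma semi_spannedM f g : semi_spanned f -> semi_spanned g -> semi_spanned (f * g).
Proof.
move=> [v [s [sv ss Is]]] [w [t [sw st It]]].
exists (v * w), [seq a * b | a <- s, b <- t]; split.
- exact: semi_invariantM.
- move=> a /allpairsP[[b c] /= [bs ct ->]]; apply: semi_invariantM; first exact: ss.
  exact: st.
rewrite big_allpairs_dep /=.
under eq_bigr do rewrite -mulr_sumr.
rewrite -mulr_suml.
have -> : v * w * (f * g) - (\sum_(i <- s) i) * (\sum_(i <- t) i)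
  = v * f * (w * g - \sum_(i <- t) i) + (\sum_(i <- t) i) * (v * f - \sum_(i <- s) i) by ring.
by apply: (idealD idI); apply: idealMl.
Qed.

Lemma semi_spanned_div w g : semi_invariant w -> semi_spanned (w * g) -> semi_spanned g.
Proof.
move=> sw [v [s [sv ss Is]]]; exists (v * w), s; split=> //.
  exact: semi_invariantM.
by rewrite -mulrA.
Qed.

Hypothesis casimirs : only_scalar_casimirs br I.
Hypothesis U_central : forall a b,
  (forall u, U u -> I (b * br a u - a * br b u)) -> central_pair br I a b.

(* Subtracting from [c u g] the bracket of [u] with [g], where [c] is the weight
   of the first term [w] of [g], leaves a shorter sum.  By induction it lies in
   [I], so that [g / w] is central modulo [I], hence a scalar. *)
Lemma semi_sum_in (s : seq A) : (forall v, v \in s -> semi_invariant v) ->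
  J (\sum_(v <- s) v) -> I (\sum_(v <- s) v).
Proof.
have [N] := ubnP (size s); elim: N s => // N IH [|w s] /=.
  by move=> _ _ _; rewrite big_nil; apply: ideal0.
rewrite ltnS => sN sws; rewrite big_cons; set g := w + _ => Jg.
have [nw Uw] : semi_invariant w by apply: sws; rewrite mem_head.
have ss v : v \in s -> semi_invariant v.
  by move=> vs; apply: sws; rewrite inE vs orbT.
have gw : central_pair br I g w.
  apply: U_central => u Uu; have [Iu|su] := U_semi Uu.
    have brI : forall a b, I a -> I (br a b) by case: ppI => _ [].
    apply: (idealB idI); apply: idealMl => //; rewrite (pbC pb); apply: idealN => //.
      exact: brI.
    exact: brI.
  have [c Ic] := Uw u Uu.
  have /choice[d Hd] : forall v, exists d : k, v \in s -> I (br u v - d *: (u * v)).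
    move=> v; case: (boolP (v \in s)) => [vs|_]; last by exists 0.
    by have [_ /(_ u Uu)[d Hd]] := ss v vs; exists d.
  (* Terms with the weight of [w] are filtered out, as a zero term would not be semi-invariant. *)
  pose t := [seq (c - d v) *: (u * v) | v <- s & c - d v != 0].
  have tE : \sum_(v <- t) v = \sum_(v <- s) (c - d v) *: (u * v).
    rewrite big_map big_filter [RHS](bigID (fun v => c - d v != 0)) /=.
    rewrite [X in _ + X]big1 ?addr0 //.
    by move=> v /negPn/eqP ->; rewrite scale0r.
  have key : I (c *: (u * g) - br u g - \sum_(v <- t) v).
    have brS : br u (\sum_(v <- s) v) = \sum_(v <- s) br u v.
      apply: (big_morph (br u)); first by move=> *; apply: pbDr.
      by rewrite (pbC pb) (pb0l pb) oppr0.
    have -> : c *: (u * g) - br u g - \sum_(v <- t) v =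
        - (br u w - c *: (u * w)) - \sum_(v <- s) (br u v - d v *: (u * v)).
      rewrite tE /g (pbDr pb) brS.
      have -> : \sum_(v <- s) (c - d v) *: (u * v) =
          c *: (u * \sum_(v <- s) v) - \sum_(v <- s) d v *: (u * v).
        rewrite mulr_sumr scaler_sumr -sumrB; apply: eq_bigr => v _; exact: scalerBl.
      rewrite sumrB mulrDr scalerDr; ring.
    apply: (idealB idI); first exact: (idealN idI).
    by rewrite big_seq; apply: ideal_sum => // v vs; apply: Hd.
  have Jt : J (\sum_(v <- t) v).
    apply: (idealBl idJ (IJ key)); apply: (idealB idJ).
      by apply: (ZI idJ); apply: idealMl.
    rewrite (pbC pb); apply: (idealN idJ); by case: ppJ => _ [_]; apply.
  have It : I (\sum_(v <- t) v).
    apply: IH => //.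
      by rewrite size_map size_filter (leq_ltn_trans (count_size _ _)).
    move=> a /mapP[v]; rewrite mem_filter => /andP[cd vs] ->.
    by apply: semi_invariantZ => //; apply: semi_invariantM => //; apply: ss.
  have Ig : I (c *: (u * g) - br u g) by apply: (idealBr idI key).
  have -> : w * br g u - g * br w u
      = w * (c *: (u * g) - br u g) + g * (br u w - c *: (u * w)).
    rewrite (pbC pb u g) (pbC pb u w) !scaleE; ring.
  by apply: (idealD idI); apply: idealMl.
(* Now [g] is [c *: w] modulo [I]; since [g] is in [J] and [w] is not, [c] must be 0. *)
have [c Ic] := casimirs (fun Iw => nw (IJ Iw)) gw.
have [c0|c0] := eqVneq c 0; first by move: Ic; rewrite c0 scale0r subr0.
case: nw; have /(ZI idJ c^-1) := idealBl idJ (IJ Ic) Jg.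
by rewrite scalerA mulVf // scale1r.
Qed.

Lemma semi_spanned_sub : (forall g, semi_spanned g) -> J `<=` I.
Proof.
move=> span g Jg; have [w [s [[nw _] ss Is]]] := span g.
apply: (primeMl prI (fun Iw => nw (IJ Iw))); apply: (idealBr idI Is).
apply: semi_sum_in => //; apply: (idealBl idJ (IJ Is)); exact: idealMl.
Qed.

End SemiInvariants.

(** * The algebra A_n *)

Section An.
Variables (k : closedFieldType) (n : nat) (Gamma : 'M[k]_n) (P Q : 'rV[k]_n).
Hypothesis char0 : [pchar k] =i pred0.
Hypothesis Gamma_skew : Gamma^T = - Gamma.
Hypothesis PneqQ : forall i, P 0 i != Q 0 i.

Local Notation A := {mpoly k[n + n]}.
Local Notation br := (An_bracket Gamma P Q).
Local Notation y := (@gen_y k n).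
Local Notation x := (@gen_x k n).

Let pb : poisson_bracket br := An_poisson_bracket P Q Gamma_skew char0.
Let G_opp i j : Gamma j i = - Gamma i j := Gamma_opp Gamma_skew i j.

(* [Om (val i).+1] is [Omega P Q i], and [Om 0 = 0]. *)
Let Om (l : nat) : A := \sum_(i < n | (i < l)%N) (Q 0 i - P 0 i) *: (y i * x i).

Let OmS (i : 'I_n) : Om i.+1 = Om i + (Q 0 i - P 0 i) *: (y i * x i).
Proof.
rewrite /Om (bigD1 i) //= addrC; congr (_ + _); apply: eq_bigl => l.
by rewrite ltnS ltn_neqAle andbC.
Qed.

Let Om0 : Om 0 = 0. Proof. exact: big1. Qed.

Let Om_ge l : (n <= l)%N -> Om l.+1 = Om l.
Proof.
move=> leqnl; apply: eq_bigl => i.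
by rewrite ltnS leq_eqVlt ltn_eqF //; apply: leq_trans leqnl.
Qed.

Let Om_omega l : Om l = 0 \/ exists i, Om l = Omega P Q i.
Proof.
elim: l => [|l IH]; first by left.
have [ltln|leqnl] := ltnP l n; first by right; exists (Ordinal ltln).
by rewrite Om_ge.
Qed.

Let br_xy i : br (x i) (y i) = Q 0 i *: (y i * x i) + Om i.
Proof. by have [_ _ _ _ ->] := An_bracket_rel Gamma P Q. Qed.

Let yy_log i j : exists c, br (y i) (y j) = c *: (y i * y j).
Proof. by have [-> _ _ _ _] := An_bracket_rel Gamma P Q; eexists. Qed.

Let xx_log i j : exists c, br (x i) (x j) = c *: (x i * x j).
Proof.
have [_ _ _ xx _] := An_bracket_rel Gamma P Q.
case: (ltngtP i j) => [ij|ji|/val_inj ->]; first by eexists; apply: xx.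
  by rewrite (pbC pb) xx // -scaleNr mulrC; eexists.
by exists 0; rewrite (pb_alt pb) scale0r.
Qed.

Let xy_log i j : i != j -> exists c, br (x i) (y j) = c *: (x i * y j).
Proof.
have [_ xy yx _ _] := An_bracket_rel Gamma P Q.
case: (ltngtP i j) => [ij _|ji _|/val_inj -> /eqP //].
  by rewrite xy // mulrC; eexists.
by rewrite (pbC pb) yx // -scaleNr mulrC; eexists.
Qed.

Let gen (t : bool) i := if t then x i else y i.

Let wt (i : nat) (j : 'I_n) := if (i < j)%N then P 0 j else Q 0 j.

(** The [Gamma] contributions of [y i] and [x i] cancel, leaving opposite weights on [y j] and
    [x j]. *)
Let pair_log t i j : i != j ->
  br (y i * x i) (gen t j) = ((-1) ^+ t * wt i j) *: (y i * x i * gen t j).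
Proof.
have [yy xy yx xx _] := An_bracket_rel Gamma P Q => nij.
have log := br_algebra (pb_leibniz pb).
rewrite /wt; case: (ltngtP i j) => [ij|ji|/val_inj eij]; last by rewrite eij eqxx in nij.
  case: t => /=.
    rewrite (log _ _ _ _ _ (yx _ _ ij) (xx _ _ ij)); congr (_ *: _); ring.
  have xy' : br (x i) (y j) = (P 0 j - Gamma i j) *: (x i * y j) by rewrite xy // mulrC.
  rewrite (log _ _ _ _ _ (yy i j) xy'); congr (_ *: _); ring.
case: t => /=.
  have yx' : br (y i) (x j) = - (P 0 i - Gamma j i) *: (y i * x j).
    by rewrite (pbC pb) xy // scaleNr.
  have xx' : br (x i) (x j) = - (Q 0 j - P 0 i + Gamma j i) *: (x i * x j).
    by rewrite (pbC pb) xx // scaleNr mulrC.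
  rewrite (log _ _ _ _ _ yx' xx'); congr (_ *: _); ring.
have xy' : br (x i) (y j) = (Q 0 j + Gamma j i) *: (x i * y j).
  by rewrite (pbC pb) yx // scaleNr opprK mulrC.
rewrite (log _ _ _ _ _ (yy i j) xy') (G_opp j i); congr (_ *: _); ring.
Qed.

(** Until the index [j] is reached, all summands of [Om l] have the weight of [P 0 j] on the
    generator; the summand [j] switches it to [Q 0 j], the weight of all later summands. *)
Let Om_gen t l j : br (Om l) (gen t j) =
  ((-1) ^+ t * (if (l <= j)%N then P 0 j else Q 0 j)) *: (Om l * gen t j).
Proof.
elim: l => [|l IH]; first by rewrite Om0 (pb0l pb) mul0r scaler0.
have [ltln|leqnl] := ltnP l n; last first.
  have jl : (j < l)%N := leq_trans (ltn_ord j) leqnl.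
  by rewrite Om_ge // IH [(l <= j)%N]leqNgt [(l < j)%N]ltnNge jl ltnW.
move: IH; rewrite -[l]/(val (Ordinal ltln)); move: (Ordinal ltln) => i /= IH {l ltln}.
rewrite OmS (pbDl pb) (pbZl pb) IH {IH}.
have [->|ij] := eqVneq i j.
  (* The term [Om j] inside [br (x j) (y j)] supplies exactly the change of weight from [P 0 j] to
     [Q 0 j]. *)
  rewrite leqnn ltnn -jacobiator_Omega (pbMl pb); congr (_ + _ *: _).
  case: t => /=; rewrite (pb_alt pb) mulr0 ?addr0 ?add0r.
    by rewrite (pbC pb) br_xy scaleN1r.
  by rewrite br_xy scale1r.
rewrite pair_log // /wt.
have -> : (i <= j)%N = (i < j)%N by rewrite leq_eqVlt val_eqE (negbTE ij).
by rewrite mulrDl scalerDr -!scalerAl !scalerA [_ * (_ * _)]mulrC.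
Qed.

(** [Om l] has opposite weights on [y i] and [x i], so it commutes with their product. *)
Let Om_Om l l' : br (Om l) (Om l') = 0.
Proof.
apply: (big_ind (fun f => br (Om l) f = 0)) => [|f g Hf Hg|i _].
- by rewrite (pbC pb) (pb0l pb) oppr0.
- by rewrite (pbDr pb) Hf Hg addr0.
- rewrite (pbZr pb) (pbMr pb); have := Om_gen true l i; have := Om_gen false l i => /= -> ->.
  rewrite expr0 expr1 mul1r mulN1r scaleNr mulrN -!scalerAr.
  have -> : y i * (Om l * x i) = x i * (Om l * y i) by ring.
  by rewrite addNr scaler0.
Qed.

(** * Nested Poisson primes with the same trace on [calP] *)

Section PrimePair.
Variables I J : set A.
Hypotheses (ppI : prime_poisson_ideal br I) (ppJ : prime_poisson_ideal br J).
Hypothesis IJ : I `<=` J.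
Hypothesis same_trace : forall a, calP P Q a -> J a -> I a.
Hypothesis casimirs : only_scalar_casimirs br I.

Let prI : prime_ideal I := proj1 ppI.
Let idI := prime_is_ideal prI.

(* Modulo [I] and up to denominators, these elements generate the algebra and
   have pairwise log-canonical brackets: where [y i] is invertible, [x i] is
   recovered from the [Om l]. *)
Let U : set A := [set u | [\/ exists i, u = y i, exists l, u = Om l |
  exists i, I (y i) /\ u = x i]].

(** Only the bracket of [x i] with [y i] can fail to be log-canonical. But [x i] is put into [U]
    only when [y i] is in [I], and then bracket and product both vanish modulo [I]. *)
Let U_log u v : U u -> U v -> log_mod br I u v.
Proof.
have log a b : (exists c, br a b = c *: (a * b)) -> log_mod br I a b.
  by move=> [c]; apply: log_modP.
have Omg t l j : log_mod br I (Om l) (gen t j).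
  by apply: log; eexists; apply: Om_gen.
have xy i j : I (y i) -> log_mod br I (x i) (y j).
  move=> Iy; have [<-|ij] := eqVneq i j; last by apply/log/xy_log.
  by apply: log_modC => //; apply: log_mod0l.
move=> [[i ->]|[l ->]|[i [Iy ->]]] [[j ->]|[l' ->]|[j [Jy ->]]].
- exact/log/yy_log.
- by apply: log_modC => //; apply: (Omg false).
- by apply: log_modC => //; apply: xy.
- exact: (Omg false).
- by apply: log; exists 0; rewrite Om_Om scale0r.
- exact: (Omg true).
- exact: xy.
- by apply: log_modC => //; apply: (Omg true).
- exact/log/xx_log.
Qed.

Let U_trace u : U u -> J u -> I u.
Proof.
move=> [[i ->]|[l ->]|[i [_ ->]]].
- by apply: same_trace; left; right; exists i.
- have [->|[i ->]] := Om_omega l; first by move=> _; apply: ideal0.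
  by apply: same_trace; left; left; exists i.
- by apply: same_trace; right; exists i.
Qed.

Let semi := semi_invariant br I J U.

Let U_semi u : U u -> I u \/ semi u.
Proof.
move=> Uu; have [Iu|nIu] := pselect (I u); [by left|right; split].
  by move/(U_trace Uu).
by move=> v Uv; apply: U_log.
Qed.

Let pair_Om i : y i * x i = (Q 0 i - P 0 i)^-1 *: (Om i.+1 - Om i).
Proof.
by rewrite OmS addrAC subrr add0r scalerA mulVf ?scale1r // subr_eq0 eq_sym.
Qed.

(** Where [y i] is outside [I], [pair_Om] yields [y i * x i] from the [Om l], so [S] must only
    survive division by such a [y i]. *)
Let gen_ind (S : A -> Prop) : (forall c, S c%:A) -> (forall f g, S f -> S g -> S (f + g)) ->
  (forall f g, S f -> S g -> S (f * g)) -> (forall u, U u -> S u) ->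
  (forall i, ~ I (y i) -> S (y i * x i) -> S (x i)) -> forall f, S f.
Proof.
move=> SC SD SM SU Sx; apply: mpoly_alg_ind => //.
  by move=> c; rewrite -alg_mpolyC.
move=> a; rewrite -(splitK a); case: (split a) => i.
  by apply: SU; constructor 1; exists i.
have [Iy|nIy] := pselect (I (y i)); first by apply: SU; constructor 3; exists i.
have SOm l : S (Om l) by apply: SU; constructor 2; exists l.
apply: (Sx i nIy); rewrite pair_Om -mulr_algl; apply: (SM) => //; apply: SD => //.
by rewrite -scaleN1r -mulr_algl; apply: SM.
Qed.

(** Both remaining conditions of [semi_spanned_sub], centrality being testable on [U] and every
    element being semi-spanned, follow by [gen_ind]. *)
Lemma eq_trace_sub : J `<=` I.
Proof.
apply: (semi_spanned_sub pb ppI ppJ IJ U_semi casimirs) => [a b Hab|].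
  apply: gen_ind => [c|f g Hf Hg|f g Hf Hg|u Uu|i nIy].
  - by rewrite !(pb_scalarr pb) !mulr0 subrr; apply: ideal0.
  - rewrite !(pbDr pb) !mulrDr opprD addrACA; exact: (idealD idI).
  - have -> : b * br a (f * g) - a * br b (f * g)
      = f * (b * br a g - a * br b g) + g * (b * br a f - a * br b f).
      by rewrite !(pbMr pb); ring.
    by apply: (idealD idI); apply: idealMl.
  - exact: Hab.
  - have Hy : I (b * br a (y i) - a * br b (y i)) by apply: Hab; constructor 1; exists i.
    move=> Hyx; apply: (primeMl prI nIy).
    have -> : y i * (b * br a (x i) - a * br b (x i)) = b * br a (y i * x i)
       - a * br b (y i * x i) - x i * (b * br a (y i) - a * br b (y i)).
      by rewrite !(pbMr pb); ring.
    by apply: (idealB idI) => //; apply: idealMl.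
apply: gen_ind => [c|f g|f g|u|i nIy].
- exact: semi_spannedC.
- exact: semi_spannedD.
- exact: semi_spannedM.
- exact: semi_spannedU.
- apply: semi_spanned_div => //; have Uy : U (y i) by constructor 1; exists i.
  by case: (U_semi Uy).
Qed.

End PrimePair.

(** If [y i] or [x i] is in [I], so is their bracket, whose only other term is [Om i]. Conversely
    [Om i.+1 - Om i] is a nonzero multiple of [y i * x i], and [I] is prime. *)
Lemma trace_admissible I : prime_poisson_ideal br I -> admissible P Q (I `&` calP P Q).
Proof.
move=> [prI [idI ID]].
have inP a : calP P Q a -> (I `&` calP P Q) a <-> I a by move=> Pa; split=> [[]|].
have Py i : calP P Q (y i) by left; right; exists i.
have Px i : calP P Q (x i) by right; exists i.
have PO i : calP P Q (Omega P Q i) by left; left; exists i.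
have OE i : Omega P Q i = Om i.+1 by [].
have key i : I (y i) \/ I (x i) <-> I (Om i.+1) /\ I (Om i).
  rewrite OmS; split=> [yx|[IS Ii]].
    have Iyx : I (y i * x i) by case: yx => ?; [apply: idealMr|apply: idealMl].
    have Ibr : I (br (x i) (y i)).
      case: yx => ?; last exact: ID.
      by rewrite (pbC pb); apply: (idealN idI); apply: ID.
    have IZ c : I (c *: (y i * x i)) by rewrite -mulr_algl; apply: idealMl.
    have Ii : I (Om i).
      move: Ibr; rewrite br_xy => Ibr.
      by rewrite -(addKr (Q 0 i *: (y i * x i)) (Om i)) addrC; apply: (idealB idI).
    by split=> //; apply: (idealD idI).
  have [_ _ prM] := prI; apply: prM.
  have nz : Q 0 i - P 0 i != 0 by rewrite subr_eq0 eq_sym.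
  have -> : y i * x i = (Q 0 i - P 0 i)^-1%:A *
      ((Om i + (Q 0 i - P 0 i) *: (y i * x i)) - Om i).
    by rewrite [_ + _ *: _]addrC addrK mulr_algl scalerA mulVf // scale1r.
  by apply: idealMl => //; apply: (idealB idI).
split; first by move=> a [].
- by move=> i j ij; rewrite !inP // !OE -ij; apply: key.
(* For the first index, [Om 0 = 0] makes half of [key] automatic. *)
- move=> i i0; rewrite !inP // OE key; split=> [[]//|H]; split=> //.
  by rewrite i0 Om0; apply: ideal0.
Qed.

Lemma casimirs_maximal I : prime_poisson_ideal br I -> only_scalar_casimirs br I ->
  maximal_elements (pspec Gamma P Q (I `&` calP P Q)) I.
Proof.
move=> ppI sc; split=> // J [ppJ E] IJ; apply/seteqP; split=> //.
apply: eq_trace_sub ppI ppJ IJ _ sc => a Pa Ja.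
by have [] : (I `&` calP P Q) a by rewrite -E.
Qed.

Lemma maximal_locally_closed T I :
  maximal_elements (pspec Gamma P Q T) I -> locally_closed br I.
Proof.
move=> [[ppI IT] Imax]; have [prI _] := ppI; have idI := prime_is_ideal prI.
split=> //; split; first by move=> a Ia J [_ [IJ _]]; apply: IJ.
(* Replacing members of [I] by 1 makes [F] the product of the entries of [calP] outside [I]. *)
pose e (a : A) : A := if `[< I a >] then 1 else a.
have ne a : ~ I (e a) by rewrite /e; case: asboolP => // _; apply: prime1.
pose F := \prod_i (e (Omega P Q i) * e (y i) * e (x i)).
have nF : ~ I F by apply: (prime_prod prI) => i _; do !apply: (primeM prI) => //.
apply: contra_not nF; apply=> J [ppJ [IJ nJI]].
have [prJ _] := ppJ; have idJ := prime_is_ideal prJ.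
(* Otherwise [J] would have the trace [T] as well, against the maximality of [I]. *)
have [a [Pa Ja nIa]] : exists a, [/\ calP P Q a, J a & ~ I a].
  apply: contrapT => H; apply: nJI; suff -> : J = I by [].
  apply: Imax => //; split=> //; rewrite -IT; apply/seteqP; split=> a [Ha Pa]; split=> //.
    by apply: contrapT => nIa; apply: H; exists a.
  exact: IJ.
have ea : e a = a by rewrite /e; case: asboolP.
have JF i : J (e (Omega P Q i) * e (y i) * e (x i)) -> J F.
  by move=> JFi; rewrite /F (bigD1 i) //=; apply: idealMr.
case: Pa => [[|]|] [i _ E]; apply: (JF i); rewrite E ea.
- by apply: idealMr => //; apply: idealMr.
- by apply: idealMr => //; apply: idealMl.
- by apply: idealMl.
Qed.

End An.

(** * The Poisson Dixmier-Moeglin equivalence for [A_n] *)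

Theorem theorem4p10 (k : closedFieldType) (n : nat)
    (Gamma : 'M[k]_n) (P Q : 'rV[k]_n)
    (char0 : [pchar k] =i pred0)
    (Gamma_skew : Gamma^T = - Gamma)
    (PneqQ : forall i, P 0 i != Q 0 i) :
  let br : {mpoly k[n + n]} -> {mpoly k[n + n]} -> {mpoly k[n + n]} :=
    An_bracket Gamma P Q in
  poisson_dixmier_moeglin br /\
  [/\ symp br = locally_closed br,
      locally_closed br = rational br &
      rational br =
        \bigcup_(T in admissible P Q) maximal_elements (pspec Gamma P Q T)].
Proof.
move=> br.
have pb : poisson_bracket br := An_poisson_bracket P Q Gamma_skew char0.
pose maxT := \bigcup_(T in admissible P Q) maximal_elements (pspec Gamma P Q T).
have max_lc : maxT `<=` locally_closed br.
  by move=> I [T _]; apply: maximal_locally_closed.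
have lc_symp : locally_closed br `<=` symp br.
  by move=> I; apply: locally_closed_symp.
have symp_rat : symp br `<=` rational br.
  move=> I sI; apply/rationalP => //; first exact: (symp_prime char0 pb).
  exact: symp_casimirs.
have rat_max : rational br `<=` maxT.
  move=> I ratI; have [ppI _] := ratI; exists (I `&` calP P Q).
    exact: trace_admissible ppI.
  by apply: casimirs_maximal => //; apply/(rationalP pb ppI).
have E1 : symp br = locally_closed br.
  apply/seteqP; split=> // I /symp_rat/rat_max/max_lc //.
have E2 : locally_closed br = rational br.
  by apply/seteqP; split=> // I; [move/lc_symp/symp_rat|move/rat_max/max_lc].
have E3 : rational br = maxT.
  by apply/seteqP; split=> // I /max_lc/lc_symp/symp_rat.
by split; [move=> I _; rewrite E1 E2|split].
Qed.
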